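(* Let $R$ be a commutative Noetherian ring, let $I, J \subseteq R$ be ideals, let $M, N$ be finitely generated $R$-modules, and let $i \geq 0$ be an integer. If $\operatorname{Tor}_i^R(I^nM,\, N/J^mN)$ has finite length for all sufficiently large $m$ and $n$, then there are a polynomial $p$ in two variables with rational coefficients and integers $m_0,n_0$ such that $$\lambda\big(\operatorname{Tor}_i^R(I^nM,\, N/J^mN)\big) = p(m,n)\quad\text{for all } m \geq m_0,\ n \geq n_0.$$
   Context: $\lambda$ denotes length of an $R$-module. The ring $R$ is not assumed to be local. ''For all sufficiently large $m$ and $n$'' means: there are integers $m_1,n_1$ such that the property holds for all $m\ge m_1$ and $n\ge n_1$. *)

(* Defs.v *)
From HB Require Import structures.
From mathcomp Require Import all_boot all_order all_algebra generic_quotient.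
From mathcomp Require Import ring_quotient.
From mathcomp Require Import finmap.
From mathcomp Require Import boolp classical_sets functions cardinality fsbigop.
From mathcomp Require Import mpoly.

Set Implicit Arguments.
Unset Strict Implicit.
Unset Printing Implicit Defensive.

Import GRing.Theory.
Local Open Scope ring_scope.
Local Open Scope quotient_scope.

(* Mathematical Components, with the classical axioms of mathcomp-classical.
   Submodules of V are the library's [submodClosed V]; an ideal of a commutative
   ring R is a submodule of the regular module R^o.  The zero ring is allowed. *)

Section SubmoduleType.
Variables (R : pzRingType) (V : lmodType R) (U : submodClosed V).

Record submod : Type := Submod { submod_val : V; _ : submod_val \in U }.

HB.instance Definition _ := [isSub for submod_val].
HB.instance Definition _ := [Choice of submod by <:].
HB.instance Definition _ := [SubChoice_isSubLmodule of submod by <:].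

Fact submod_val_linear : linear submod_val.
Proof. by move=> a u v; exact: (linearP (val : submod -> V)). Qed.
HB.instance Definition _ :=
  GRing.isLinear.Build R submod V *:%R submod_val submod_val_linear.

End SubmoduleType.

Section QuotientModule.
Variables (R : pzRingType) (V : lmodType R) (U : submodClosed V).

(* The library's quotient of abelian groups takes a [zmodClosed V]. *)
Definition subgroup : {pred V} := U.

Fact subgroup_closed : zmod_closed subgroup.
Proof. by split=> [|x y Ux Uy]; rewrite ?rpred0 // -scaleN1r rpredD ?rpredZ. Qed.
HB.instance Definition _ := GRing.isZmodClosed.Build V subgroup subgroup_closed.

Definition quotmod : Type := Quotient.quot subgroup.

HB.instance Definition _ := GRing.Zmodule.on quotmod.
HB.instance Definition _ := Quotient.on quotmod.

Definition quotmod_pi (x : V) : quotmod := \pi_(Quotient.quot subgroup) x.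
Definition quotmod_scale (a : R) (q : quotmod) : quotmod :=
  quotmod_pi (a *: repr q).

Lemma quotmod_piP (x y : V) :
  quotmod_pi x = quotmod_pi y <-> x - y \in U.
Proof.
rewrite /quotmod_pi; split=> [/eqP|H]; first by rewrite -Quotient.idealrBE.
by apply/eqP; rewrite -Quotient.idealrBE.
Qed.

Lemma quotmod_reprK (q : quotmod) : quotmod_pi (repr q) = q.
Proof. exact: reprK. Qed.

Lemma quotmod_pi_additive (x y : V) :
  quotmod_pi (x + y) = quotmod_pi x + quotmod_pi y.
Proof. exact: (raddfD (\pi_(Quotient.quot subgroup) : {additive V -> Quotient.quot subgroup})). Qed.

Lemma quotmod_pi_scale (a : R) (x : V) :
  quotmod_pi (a *: x) = quotmod_scale a (quotmod_pi x).
Proof.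
apply/quotmod_piP; rewrite -scalerBr rpredZ //.
by apply/quotmod_piP; rewrite quotmod_reprK.
Qed.

Lemma quotmod_scaleA (a b : R) (q : quotmod) :
  quotmod_scale a (quotmod_scale b q) = quotmod_scale (a * b) q.
Proof.
by rewrite -(quotmod_reprK q) -!quotmod_pi_scale scalerA.
Qed.

Lemma quotmod_scale1 : left_id 1 quotmod_scale.
Proof. by move=> q; rewrite /quotmod_scale scale1r quotmod_reprK. Qed.

Lemma quotmod_scaleDr : right_distributive quotmod_scale +%R.
Proof.
move=> a p q; rewrite -(quotmod_reprK p) -(quotmod_reprK q).
by rewrite -quotmod_pi_additive -!quotmod_pi_scale scalerDr quotmod_pi_additive.
Qed.

Lemma quotmod_scaleDl (q : quotmod) :
  {morph quotmod_scale^~ q : a b / a + b}.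
Proof. by move=> a b; rewrite /quotmod_scale scalerDl quotmod_pi_additive. Qed.

HB.instance Definition _ := GRing.Zmodule_isLmodule.Build R quotmod
  quotmod_scaleA quotmod_scale1 quotmod_scaleDr quotmod_scaleDl.

Lemma quotmod_pi_linear : linear quotmod_pi.
Proof.
by move=> a x y; rewrite quotmod_pi_additive quotmod_pi_scale.
Qed.

HB.instance Definition _ :=
  GRing.isLinear.Build R V quotmod *:%R quotmod_pi quotmod_pi_linear.

Section Lift.
Variables (W : lmodType R) (f : {linear V -> W}).

Definition quotmod_lift of (forall x, x \in U -> f x = 0) :=
  fun q : quotmod => f (repr q).

Hypothesis f0 : forall x, x \in U -> f x = 0.

Lemma quotmod_liftE (x : V) : quotmod_lift f0 (quotmod_pi x) = f x.
Proof.
apply/eqP; rewrite -subr_eq0 -raddfB; apply/eqP; apply: f0.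
by apply/quotmod_piP; rewrite quotmod_reprK.
Qed.

Lemma quotmod_lift_linear : linear (quotmod_lift f0).
Proof.
move=> a p q; rewrite -(quotmod_reprK p) -(quotmod_reprK q).
by rewrite -linearP !quotmod_liftE linearP.
Qed.

HB.instance Definition _ := GRing.isLinear.Build R quotmod W *:%R
  (quotmod_lift f0) quotmod_lift_linear.
End Lift.

End QuotientModule.

Section Submodules.
Variables (R : pzRingType) (V : lmodType R).

Definition fullm : {pred V} := fun=> true.

Fact fullm_closed : submod_closed fullm. Proof. by []. Qed.
HB.instance Definition _ := GRing.isSubmodClosed.Build R V fullm
  (GRing.submod_closed_semi fullm_closed).

Definition span (S : set V) : {pred V} := fun x =>
  `[< forall U : submodClosed V, (forall y, S y -> y \in U) -> x \in U >].

Fact span_closed (S : set V) : submod_closed (span S).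
Proof.
split=> [|a x y /asboolP Sx /asboolP Sy]; apply/asboolP => U SU.
  exact: rpred0.
by rewrite rpredD ?rpredZ ?Sx ?Sy.
Qed.
HB.instance Definition _ (S : set V) := GRing.isSubmodClosed.Build R V (span S)
  (GRing.submod_closed_semi (span_closed S)).

Variables (W : lmodType R) (f : {linear V -> W}).

Definition kerm : {pred V} := fun x => f x == 0.

Fact kerm_closed : submod_closed kerm.
Proof.
split=> [|a x y /eqP fx /eqP fy]; apply/eqP; first exact: raddf0.
by rewrite linearP fx fy scaler0 addr0.
Qed.
HB.instance Definition _ := GRing.isSubmodClosed.Build R V kerm
  (GRing.submod_closed_semi kerm_closed).

Definition imm : {pred W} := fun y => `[< exists x, f x = y >].

Fact imm_closed : submod_closed imm.
Proof.
split=> [|a x y /asboolP[x' <-] /asboolP[y' <-]]; apply/asboolP.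
  by exists 0; rewrite raddf0.
by exists (a *: x' + y'); rewrite linearP.
Qed.
HB.instance Definition _ := GRing.isSubmodClosed.Build R W imm
  (GRing.submod_closed_semi imm_closed).

End Submodules.

Arguments fullm {R V}.

Section FinitelyGenerated.
Variable R : pzRingType.

Definition fg_submod (V : lmodType R) (U : submodClosed V) : Prop :=
  exists s : seq V, forall x, (x \in U) = (x \in span [set y | y \in s]).

Definition fg_module (V : lmodType R) : Prop := fg_submod (@fullm R V).

End FinitelyGenerated.

Definition noetherian_ring (R : comPzRingType) : Prop :=
  forall I : submodClosed R^o, fg_submod I.

Section IdealPowers.
Variables (R : comPzRingType).

(* I * U, for an ideal I and a submodule U; for V := R^o this is the product of
   two ideals. *)
Definition ideal_mul (V : lmodType R) (I : submodClosed R^o)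
    (U : submodClosed V) : submodClosed V :=
  span [set z | exists a x, [/\ a \in I, x \in U & z = (a : R) *: x]].

Definition ideal_exp (I : submodClosed R^o) (n : nat) : submodClosed R^o :=
  iter n (ideal_mul I) fullm.

(* I ^ n * V as a submodule of V *)
Definition ideal_exp_mod (I : submodClosed R^o) (n : nat) (V : lmodType R) :
  submodClosed V := ideal_mul (ideal_exp I n) fullm.

End IdealPowers.

Section Length.
Variables (R : pzRingType) (V : lmodType R).

(* There is a chain U 0 < U 1 < ... < U l of l + 1 submodules of V. *)
Definition has_chain (l : nat) : Prop :=
  exists U : nat -> submodClosed V, forall k, (k < l)%N ->
    (forall x, x \in U k -> x \in U k.+1) /\
    (exists2 x, x \in U k.+1 & x \notin U k).

(* The length of V is the supremum of the lengths of its chains of submodules;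
   [has_length l] says that it is finite and equal to l. *)
Definition has_length (l : nat) : Prop :=
  has_chain l /\ forall k, has_chain k -> (k <= l)%N.

Definition finite_length : Prop := exists l, has_length l.

End Length.

Section FreeModule.
Variables (R : pzRingType) (X : choiceType).

Definition fin_supp : {pred X -> R^o} :=
  fun u => `[< finite_set [set x | u x != 0] >].

Fact fin_supp_closed : submod_closed fin_supp.
Proof.
split=> [|a u v /asboolP fu /asboolP fv]; apply/asboolP.
  by apply: (sub_finite_set _ (finite_set0 X)) => x /=; rewrite eqxx.
have : finite_set ([set x | u x != 0] `|` [set x | v x != 0])%classic.
  by rewrite finite_setU.
apply: sub_finite_set => x /= uv0.
have [u0|] := eqVneq (u x) 0; last by left.
by right; apply: contraNneq uv0 => v0; rewrite !fctE u0 v0 scaler0 addr0.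
Qed.
HB.instance Definition _ := GRing.isSubmodClosed.Build R (X -> R^o) fin_supp
  (GRing.submod_closed_semi fin_supp_closed).

(* The free R-module with basis X: finitely supported functions X -> R. *)
Definition free : lmodType R := submod fin_supp.

Fact free_basis_subproof (x : X) :
  (fun y => if y == x then 1 else 0) \in fin_supp.
Proof.
apply/asboolP; apply: (sub_finite_set _ (finite_set1 x)) => y /=.
by case: (y =P x) => // _; rewrite eqxx.
Qed.

Definition free_basis (x : X) : free := Submod (free_basis_subproof x).

(* The linear map free X -> V extending g : X -> V. *)
Definition free_lift (V : lmodType R) (g : X -> V) (u : free) : V :=
  \sum_(x \in [set: X]) (submod_val u x : R) *: g x.

Lemma free_liftE (V : lmodType R) (g : X -> V) (u : free) (A : seq X) :
    uniq A -> (forall x, x \notin A -> submod_val u x = 0) ->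
  free_lift g u = \sum_(x <- A) (submod_val u x : R) *: g x.
Proof.
move=> uA u0; rewrite /free_lift (fsbigTE (seq_fset tt A)).
  by apply: perm_big; rewrite -{2}(undup_id uA); exact: seq_fset_perm.
by move=> x; rewrite seq_fsetE => /u0 ->; rewrite scale0r.
Qed.

Lemma free_suppP (u : free) :
  exists A : seq X, forall x, x \notin A -> submod_val u x = 0.
Proof.
case: u => u /= /[dup] /asboolP /finite_seqP[A uA] _; exists A => x xA.
apply/eqP; apply: contraNT xA => ux0.
by have : [set x | u x != 0]%classic x by []; rewrite uA.
Qed.

Lemma free_lift_linear (V : lmodType R) (g : X -> V) : linear (free_lift g).
Proof.
move=> a u v; have [A uA] := free_suppP u; have [B vB] := free_suppP v.
pose C := undup (A ++ B).
have uC x : x \notin C -> submod_val u x = 0.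
  by rewrite mem_undup mem_cat => /norP[/uA].
have vC x : x \notin C -> submod_val v x = 0.
  by rewrite mem_undup mem_cat => /norP[_ /vB].
rewrite !(@free_liftE _ _ _ C) ?undup_uniq //; last first.
  by move=> x xC; rewrite submod_val_linear /= !fctE uC // vC // scaler0 addr0.
rewrite scaler_sumr -big_split; apply: eq_bigr => x _.
by rewrite submod_val_linear !fctE scalerDl scalerA.
Qed.
HB.instance Definition _ (V : lmodType R) (g : X -> V) :=
  GRing.isLinear.Build R free V *:%R (free_lift g) (free_lift_linear g).

Lemma free_liftZ (V : lmodType R) (g : X -> V) a u :
  free_lift g (a *: u) = a *: free_lift g u.
Proof. by rewrite -[a *: u]addr0 free_lift_linear raddf0 addr0. Qed.

Lemma free_lift_basis (V : lmodType R) (g : X -> V) (x : X) :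
  free_lift g (free_basis x) = g x.
Proof.
rewrite (@free_liftE _ _ _ [:: x]) //; last first.
  by move=> y; rewrite inE /= => /negPf ->.
by rewrite big_seq1 /= eqxx scale1r.
Qed.

End FreeModule.

Arguments free : clear implicits.
Arguments free_basis {R X}.

Section Tensor.
Variables (R : comPzRingType) (A B : lmodType R).

Inductive tensor_rel : set (free R (A * B)%type) :=
| TensorDl a a' b : tensor_rel
    (free_basis (a + a', b) - free_basis (a, b) - free_basis (a', b))
| TensorDr a b b' : tensor_rel
    (free_basis (a, b + b') - free_basis (a, b) - free_basis (a, b'))
| TensorZl r a b : tensor_rel (free_basis (r *: a, b) - r *: free_basis (a, b))
| TensorZr r a b : tensor_rel (free_basis (a, r *: b) - r *: free_basis (a, b)).

Definition tensor : lmodType R :=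
  quotmod (span tensor_rel).

Definition tens (a : A) (b : B) : tensor :=
  quotmod_pi _ (free_basis (a, b)).

Lemma tens_rel0 (z : free R (A * B)%type) :
  tensor_rel z -> quotmod_pi (span tensor_rel) z = 0.
Proof.
move=> rz; rewrite -(raddf0 (quotmod_pi (span tensor_rel))).
by apply/quotmod_piP; rewrite subr0; apply/asboolP => U; apply.
Qed.

Lemma tensDl (a a' : A) b :
  tens (a + a') b = tens a b + tens a' b.
Proof.
by have := tens_rel0 (TensorDl a a' b); rewrite !raddfB /= -addrA -opprD
  => /subr0_eq.
Qed.

Lemma tensDr (a : A) b b' :
  tens a (b + b') = tens a b + tens a b'.
Proof.
by have := tens_rel0 (TensorDr a b b'); rewrite !raddfB /= -addrA -opprD
  => /subr0_eq.
Qed.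

Lemma tensZl r (a : A) b : tens (r *: a) b = r *: tens a b.
Proof.
by have := tens_rel0 (TensorZl r a b); rewrite raddfB /= quotmod_pi_scale
  => /subr0_eq.
Qed.

Lemma tensZr r (a : A) b : tens a (r *: b) = r *: tens a b.
Proof.
by have := tens_rel0 (TensorZr r a b); rewrite raddfB /= quotmod_pi_scale
  => /subr0_eq.
Qed.

End Tensor.

Arguments tensor_rel {R} A B _.

Section TensorMap.
Variables (R : comPzRingType) (A A' B : lmodType R) (f : {linear A -> A'}).

Fact tensor_map_subproof (z : free R (A * B)%type) :
  z \in span (tensor_rel A B) ->
  free_lift (fun ab => tens (f ab.1) ab.2) z = 0.
Proof.
move=> /asboolP/(_ (kerm (free_lift (fun ab => tens (f ab.1) ab.2)))) kz.
apply/eqP; apply: kz => _ []; move=> *; apply/eqP;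
  rewrite !raddfB /= ?free_liftZ !free_lift_basis /= ?raddfD /=.
- by rewrite tensDl addrAC addrK subrr.
- by rewrite tensDr addrAC addrK subrr.
- by rewrite linearZ tensZl subrr.
- by rewrite tensZr subrr.
Qed.

(* f (x) id_B : A (x) B -> A' (x) B *)
Definition tensor_map : {linear tensor A B -> tensor A' B} :=
  quotmod_lift tensor_map_subproof.

Lemma tensor_mapE a b : tensor_map (tens a b) = tens (f a) b.
Proof. exact: etrans (quotmod_liftE _ _) (free_lift_basis _ _). Qed.

End TensorMap.

(* Tor is the homology of F (x) B, where F is the standard free resolution
     ... -> F 2 -> F 1 -> F 0 -> A -> 0
   of A: F 0 is free on the set A, and F (k + 1) is free on the kernel of the
   previous map. *)
Section Tor.
Variables (R : comPzRingType) (A B : lmodType R).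

Definition augmentation (V : lmodType R) : {linear free R V -> V} :=
  free_lift (@id V).

Fixpoint syzygy (k : nat) : lmodType R :=
  if k is k'.+1 then submod (kerm (augmentation (syzygy k'))) else A.

Definition resolution (k : nat) : lmodType R := free R (syzygy k).

Definition differential (k : nat) :
    {linear resolution k.+1 -> resolution k} :=
  @submod_val _ _ (kerm (augmentation (syzygy k)))
    \o augmentation (syzygy k.+1).

Lemma augmentation_surj (V : lmodType R) (x : V) : exists u, augmentation V u = x.
Proof. by exists (free_basis x); exact: free_lift_basis. Qed.

Lemma differential_exact (k : nat) (u : resolution k.+1) :
  (exists v, differential k.+1 v = u) <-> differential k u = 0.
Proof.
have valI := @val_inj _ _ (submod (kerm (augmentation (syzygy k)))).
split=> [[v <-]|du0] /=.
  case: (augmentation (syzygy k.+2) v) => w /= /eqP ->; exact: raddf0.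
have ku : u \in kerm (augmentation (syzygy k.+1)).
  by apply/eqP; apply: valI; rewrite [LHS]du0 [RHS]raddf0.
have [v vu] := augmentation_surj (Submod ku : syzygy k.+2).
by exists v; rewrite /= vu.
Qed.

Definition Tor_cycles (i : nat) : submodClosed (tensor (resolution i) B) :=
  if i is k.+1 then kerm (tensor_map B (differential k)) else fullm.

Definition Tor_boundaries (i : nat) : submodClosed (tensor (resolution i) B) :=
  imm (tensor_map B (differential i)).

(* The quotient of the cycles by (the preimage in them of) the boundaries. *)
Definition Tor (i : nat) : lmodType R :=
  quotmod (kerm (quotmod_pi (Tor_boundaries i) \o @submod_val _ _ (Tor_cycles i))).

End Tor.

(* Main.v *)
(* The Rees module of M, with pieces I ^ n M, is a finitely generated graded module over
   S = R[X_1, ..., X_r], where r is the number of generators of I, and has a graded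
   resolution by finitely generated free S-modules P_k. In degree n this is a free
   resolution of I ^ n M over R, so with C_k = P_k (x) N the module
   Tor_i (I ^ n M, N / J ^ m N) is the degree n part of the homology of C / J ^ m C at C_i.
   Let Z_m be the cycles modulo J ^ m and B_m = d C_(i+1) + J ^ m C_i, and split the
   inclusion of B_m into Z_m at Q_m = ker d + J ^ m C_i. By Artin-Rees, Z_m / Q_m is
   the component of a finitely generated module over the bigraded ring R[X, Y], with Y
   acting by generators of J. The quotient Q_m / B_m is ker d / G_m for a decreasing
   sequence G_m containing d C_(i+1), and the G_m / G_(m+1) again form such a
   bigraded module. Lengths of components of bigraded modules are eventually polynomial
   by induction on the number of variables, hence so is the length of Z_m / B_m.

   All graded modules are families of submodules V m n of one ambient R-module, on which
   the variables act as commuting endomorphisms; the sum of the V m n need not be direct. *)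

From HB Require Import structures.
Require Import Defs.
From mathcomp Require Import all_boot all_order all_algebra mpoly.
From mathcomp Require Import boolp classical_sets functions.
Import Defs.
Import GRing.Theory.
Local Open Scope ring_scope.

Set Implicit Arguments.
Unset Strict Implicit.
Unset Printing Implicit Defensive.

Local Open Scope classical_set_scope.

(** * Relative length of submodules *)

(** Since R is not local and finiteness is known only for the homology with m and n large, the
    modules C_i / J ^ m C_i may have infinite length, and no length of a single term of the complex
    can be used. Only subquotients lying between boundaries and cycles are measured, so length is
    attached to a pair U <= W, and finiteness is always inherited from a larger pair. For the same
    reason finite generation is stated modulo a second family, and quotient modules are hardly ever
    formed. Tor is defined by the resolution on the sets of all elements, which has no finiteness at
    all. It is compared with the graded resolution for each n separately; only the graded resolution
    has to be uniform in n. *)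

Section SubmoduleSets.
Variables (R : pzRingType) (V : lmodType R).
Implicit Types U W T : set V.

Definition submodset U := U 0 /\ forall a x y, U x -> U y -> U (a *: x + y).

(** The form x - u asks for a witness of one summand only. *)
Definition sumset U W : set V := [set x | exists2 u, U u & W (x - u)].

Lemma submodset0 U : submodset U -> U 0. Proof. by case. Qed.

Lemma submodsetP U a x y : submodset U -> U x -> U y -> U (a *: x + y).
Proof. by case=> _; apply. Qed.

Lemma submodsetZ U a x : submodset U -> U x -> U (a *: x).
Proof. by move=> hU Ux; rewrite -[a *: x]addr0; apply: submodsetP => //; case: hU. Qed.

Lemma submodsetD U x y : submodset U -> U x -> U y -> U (x + y).
Proof. by move=> hU Ux Uy; rewrite -[x]scale1r; apply: submodsetP. Qed.

Lemma submodsetN U x : submodset U -> U x -> U (- x).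
Proof. by move=> hU Ux; rewrite -scaleN1r; apply: submodsetZ. Qed.

Lemma submodsetB U x y : submodset U -> U x -> U y -> U (x - y).
Proof. by move=> hU Ux Uy; apply: submodsetD => //; apply: submodsetN. Qed.

Lemma submodsetI U W : submodset U -> submodset W -> submodset (U `&` W).
Proof.
move=> hU hW; split; first by split; apply: submodset0.
by move=> a x y [? ?] [? ?]; split; apply: submodsetP.
Qed.

Lemma submodset_sumset U W : submodset U -> submodset W -> submodset (sumset U W).
Proof.
move=> hU hW; split; first by exists 0; rewrite ?subr0; apply: submodset0.
move=> a x y [u Uu Wu] [v Uv Wv]; exists (a *: u + v); first exact: submodsetP.
by rewrite opprD addrACA -scalerBr; apply: submodsetP.
Qed.

Lemma submodset_setT : submodset setT. Proof. by []. Qed.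

Lemma submodset_set0 : submodset [set 0].
Proof. by split=> // a x y -> ->; rewrite scaler0 addr0. Qed.

Lemma sumsetl U W : submodset W -> U `<=` sumset U W.
Proof. by move=> hW u Uu; exists u; rewrite ?subrr //; apply: submodset0. Qed.

Lemma sumsetr U W : submodset U -> W `<=` sumset U W.
Proof. by move=> hU w Ww; exists 0; rewrite ?subr0 //; apply: submodset0. Qed.

Lemma sumset_min U W T : submodset T -> U `<=` T -> W `<=` T -> sumset U W `<=` T.
Proof.
move=> hT UT WT x [u /UT Tu /WT Tx].
by rewrite -[x](subrK u) addrC; apply: submodsetD.
Qed.

Lemma sumset_mono U W U' W' : U `<=` U' -> W `<=` W' ->
  sumset U W `<=` sumset U' W'.
Proof. by move=> UU WW x [u /UU ? /WW ?]; exists u. Qed.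

(** The proof [hU] is an argument so that the predicate determines the bundled submodule
    structure. *)
Definition asub U (hU : submodset U) : {pred V} := fun x => `[< U x >].

Fact asub_closed U (hU : submodset U) : submod_closed (asub hU).
Proof.
split=> [|a x y /asboolP Ux /asboolP Uy]; apply/asboolP; first by case: hU.
exact: submodsetP.
Qed.
HB.instance Definition _ U (hU : submodset U) :=
  GRing.isSubmodClosed.Build R V (asub hU)
    (GRing.submod_closed_semi (asub_closed hU)).

Lemma submodset_closed (U : submodClosed V) : submodset [set x | x \in U].
Proof. by split=> /= [|a x y Ux Uy]; rewrite ?rpred0 // rpredD ?rpredZ. Qed.

Lemma span_minset (S : set V) U : submodset U -> S `<=` U ->
  forall x, x \in span S -> U x.
Proof.
move=> hU SU x /asboolP/(_ (asub hU)) h; apply/asboolP.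
by apply: h => y /SU Uy; apply/asboolP.
Qed.

Lemma sub_span (S : set V) x : S x -> x \in span S.
Proof. by move=> Sx; apply/asboolP => U; apply. Qed.

End SubmoduleSets.

Section LinearImages.
Variables (R : pzRingType) (V W : lmodType R) (f : {linear V -> W}).

Lemma submodset_preimage (U : set W) : submodset U -> submodset (f @^-1` U).
Proof.
move=> hU; split=> [|a x y] /=; first by rewrite raddf0; case: hU.
by rewrite linearP => ? ?; apply: submodsetP.
Qed.

Lemma submodset_image (U : set V) : submodset U -> submodset (f @` U).
Proof.
move=> hU; split=> [|a _ _ [x Ux <-] [y Uy <-]].
  by exists 0; rewrite ?raddf0 //; case: hU.
by exists (a *: x + y); rewrite ?linearP //; apply: submodsetP.
Qed.

Lemma submodset_eq (g : {linear V -> W}) : submodset [set x | f x = g x].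
Proof.
split=> [|a x y /= fx fy]; first by rewrite /= !raddf0.
by rewrite /= !linearP fx fy.
Qed.

End LinearImages.

Section RelativeLength.
Variables (R : pzRingType) (V : lmodType R).
Implicit Types U W T : set V.

(** The last member is only required to lie in W. This makes chains monotone in W and antitone in U,
    and the end points need not be submodules. *)
Fixpoint rchain l U W : Prop :=
  if l is l'.+1 then
    exists T, [/\ submodset T, U `<=` T, ~ T `<=` U & rchain l' T W]
  else U `<=` W.

Definition rlen U W l := rchain l U W /\ forall k, rchain k U W -> (k <= l)%N.

Definition rfin U W := exists l, rlen U W l.

(** The value is 0 when there is no finite length, so [len] is meaningful only together with
    [rfin]. *)
Definition len U W : nat := xget 0%N [set l | rlen U W l].

Lemma rchain_sub l U W : rchain l U W -> U `<=` W.
Proof.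
elim: l U => [|l IH] U //= [T [hT UT _ /IH TW]]; exact: subset_trans TW.
Qed.

Lemma rchain_top l U W W' : W `<=` W' -> rchain l U W -> rchain l U W'.
Proof.
move=> WW; elim: l U => [|l IH] U /=; first by move=> UW; apply: subset_trans WW.
by move=> [T [hT UT nTU /IH c]]; exists T.
Qed.

Lemma rchain_bot l U U' W : U' `<=` U -> rchain l U W -> rchain l U' W.
Proof.
move=> UU; case: l => [|l] /=; first exact: subset_trans.
move=> [T [hT UT nTU c]]; exists T; split => //; first exact: subset_trans UT.
by move=> TU'; apply: nTU; apply: subset_trans UU.
Qed.

Lemma rchain_cat a b U W T : rchain a U W -> rchain b W T -> rchain (a + b) U T.
Proof.
elim: a U => [|a IH] U /=; first exact: rchain_bot.
by move=> [X [hX UX nXU c1]] c2; exists X; split => //; apply: IH.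
Qed.

(* By the modular law, a strict inclusion in the chain remains strict after
   intersection with T or after addition of T. *)
Lemma rchain_split l U W T : submodset U -> submodset T -> rchain l U W ->
  exists a b, [/\ (l <= a + b)%N, rchain a (U `&` T) (W `&` T) &
                rchain b (sumset U T) (sumset W T)].
Proof.
move=> + hT; elim: l U => [|l IH] U hU /=.
  by move=> UW; exists 0%N, 0%N; split=> //; [apply: setSI | apply: sumset_mono].
move=> [X [hX UX nXU /(IH _ hX)[a [b [lab ca cb]]]]].
have [XU|nXT] := pselect (X `&` T `<=` U `&` T).
  exists a, b.+1; rewrite addnS ltnS; split => //.
    by apply: rchain_bot ca => x [/UX].
  exists (sumset X T); split=> //; first exact: submodset_sumset.
    exact: sumset_mono.
  move=> XTU; apply: nXU => x Xx; have [u Uu Tu] := XTU _ (sumsetl hT Xx).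
  rewrite -[x](subrK u); apply: submodsetD => //.
  by have [|] // := XU (x - u); split=> //; apply: submodsetB => //; apply: UX.
exists a.+1, b; rewrite addSn ltnS; split => //.
  by exists (X `&` T); split=> //; [apply: submodsetI | apply: setSI].
by apply: rchain_bot cb; apply: sumset_mono.
Qed.

Lemma rlen_uniq U W k l : rlen U W k -> rlen U W l -> k = l.
Proof.
by move=> [ck mk] [cl ml]; apply/eqP; rewrite eqn_leq ml // mk.
Qed.

Lemma lenP U W : rfin U W -> rlen U W (len U W).
Proof. by case=> l hl; rewrite /len; case: xgetP => [k _|/(_ l)]. Qed.

Lemma lenE U W l : rlen U W l -> len U W = l.
Proof. by move=> h; apply: (rlen_uniq (lenP _) h); exists l. Qed.

Lemma rlen_exists U W k : U `<=` W -> (forall l, rchain l U W -> (l <= k)%N) ->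
  rfin U W.
Proof.
move=> UW bd; have ex : exists l, `[< rchain l U W >] by exists 0%N; apply/asboolP.
have bd' l : `[< rchain l U W >] -> (l <= k)%N by move/asboolP; apply: bd.
case: (ex_maxnP ex bd') => l /asboolP cl ml; exists l; split => // j cj.
by apply: ml; apply/asboolP.
Qed.

(** Splitting a longest chain at T bounds the length from above, concatenation from below.
    Finiteness of both parts is a conclusion: this is how it passes from the homology to the
    subquotients. *)
Lemma rlen_add U T W : submodset U -> submodset T -> submodset W ->
    U `<=` T -> T `<=` W -> rfin U W ->
  [/\ rfin U T, rfin T W & len U W = (len U T + len T W)%N].
Proof.
move=> hU hT hW UT TW [l [cl ml]].
have f1 : rfin U T.
  by apply: (@rlen_exists _ _ l) => // k /(rchain_top TW)/ml.
have f2 : rfin T W.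
  by apply: (@rlen_exists _ _ l) => // k /(rchain_bot UT)/ml.
split=> //; rewrite (@lenE U W l) //.
have [c1 m1] := lenP f1; have [c2 m2] := lenP f2.
apply/eqP; rewrite eqn_leq ml ?andbT; last exact: rchain_cat c1 c2.
have [a [b [lab ca cb]]] := rchain_split hU hT cl.
apply: leq_trans lab _; apply: leq_add; [apply: m1 | apply: m2].
  apply: (rchain_bot (U := U `&` T)); first by move=> x Ux; split=> //; apply: UT.
  by apply: (rchain_top _ ca) => x [].
apply: (rchain_bot _ (rchain_top _ cb)); first exact: sumsetr.
by apply: sumset_min.
Qed.

End RelativeLength.

Section LengthMap.
Variables (R : pzRingType) (V V' : lmodType R) (f : {linear V -> V'}).
Variables (W : set V) (U : set V').
Hypotheses (hW : submodset W) (hU : submodset U).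

Let K := W `&` f @^-1` U.
Let S := sumset U (f @` W).

(** The map f induces an isomorphism from W / K to S / U. Chains are carried across by adding U to
    the image in one direction and by intersecting the preimage with W in the other. *)
Let rchain_map l : rchain l K W <-> rchain l U S.
Proof.
split.
  have hS : sumset U (f @` K) = U.
    apply/seteqP; split; last exact/sumsetl/submodset_image/submodsetI/submodset_preimage.
    by apply: sumset_min => // _ [x [_ Ux] <-].
  rewrite -{1}hS /S; have : K `<=` K by [].
  have : submodset K by apply: submodsetI; last exact: submodset_preimage.
  suff H T : submodset T -> K `<=` T -> rchain l T W ->
    rchain l (sumset U (f @` T)) (sumset U (f @` W)) by exact: H.
  elim: l T => [|l IH] T hT KT /=.
    by move=> TW; apply: sumset_mono => //; apply: image_subset.
  move=> [X [hX TX nXT c]]; exists (sumset U (f @` X)); split.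
  - exact/submodset_sumset/submodset_image.
  - by apply: sumset_mono => //; apply: image_subset.
  - move=> sub; apply: nXT => x Xx.
    have Xfx : sumset U (f @` X) (f x) by apply: sumsetr => //; exists x.
    have [u Uu [t Tt ftu]] := sub _ Xfx.
    rewrite -[x](subrK t); apply: submodsetD => //; apply: KT; split.
      apply: submodsetB => //; first exact: (rchain_sub c).
      exact/(rchain_sub c)/TX.
    by rewrite /= raddfB /= ftu opprB addrC subrK.
  - by apply: IH => //; apply: subset_trans TX.
suff H T : submodset T -> U `<=` T -> rchain l T S ->
  rchain l (W `&` f @^-1` T) W by apply: H.
elim: l T => [|l IH] T hT UT /=; first by move=> _ x [].
move=> [X [hX TX nXT c]]; have XS := rchain_sub c.
exists (W `&` f @^-1` X); split.
- by apply: submodsetI => //; apply: submodset_preimage.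
- by move=> x [? /TX].
- move=> sub; apply: nXT => x Xx; have [u Uu [w Ww fw]] := XS _ Xx.
  have Tu := UT _ Uu.
  have /sub[_ /= Tfw] : (W `&` f @^-1` X) w.
    by split=> //=; rewrite fw; apply: submodsetB => //; apply: TX.
  by rewrite -[x](subrK u); apply: submodsetD => //; rewrite -fw.
- by apply: IH => //; apply: subset_trans TX.
Qed.

Lemma rlen_map l : rlen K W l <-> rlen U S l.
Proof.
split=> -[c m]; split=> [|k ck]; try exact/rchain_map; apply: m; exact/rchain_map.
Qed.

End LengthMap.

Lemma has_lengthE (R : pzRingType) (V : lmodType R) l :
  has_length V l <-> rlen [set 0 : V] setT l.
Proof.
suff E k : has_chain V k <-> rchain k [set 0 : V] setT.
  by split=> -[c m]; split=> [|j cj]; try exact/E; apply: m; exact/E.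
split.
  case=> U hU; apply: (@rchain_bot _ _ _ [set y | y \in U 0%N]).
    by move=> _ ->; rewrite /= rpred0.
  elim: k U hU => [|k IH] U hU; first exact: subsetT.
  have [U01 [x U1x U0x]] := hU 0%N erefl.
  exists [set y | y \in U 1%N]; split=> //; first exact: submodset_closed.
    by move=> /(_ x U1x) /=; apply/negP.
  exact: (IH (fun k => U k.+1) (fun k => hU k.+1)).
suff H (Z : set V) : submodset Z -> rchain k Z setT ->
    exists U : nat -> submodClosed V, (forall x, (x \in U 0%N) <-> Z x) /\
      forall j, (j < k)%N -> (forall x, x \in U j -> x \in U j.+1) /\
        (exists2 x, x \in U j.+1 & x \notin U j).
  by move=> /(H _ (submodset_set0 _))[U [_ hU]]; exists U.
elim: k Z => [|k IH] Z hZ.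
  by exists (fun=> asub hZ : submodClosed V); split=> // x; split=> /asboolP.
move=> /= [T [hT ZT nTZ /(IH _ hT)[U [U0 hU]]]].
exists (fun j => if j is j'.+1 then U j' else asub hZ : submodClosed V).
split=> [x|[_|j /hU//]]; first by split=> /asboolP.
split=> [x /asboolP/ZT/U0 //|].
have /existsNP[x /not_implyP[Tx nZx]] := nTZ.
by exists x; [apply/U0 | apply/asboolP].
Qed.

(** The form of [rlen_map] used for comparisons: K and S are characterised instead of computed, and
    f has to be surjective only modulo U. *)
Lemma rlen_map_onto (R : pzRingType) (V V' : lmodType R) (f : {linear V -> V'})
    (K W : set V) (U S : set V') l :
    submodset W -> submodset U -> submodset S ->
    (forall x, W x -> (K x <-> U (f x))) -> K `<=` W -> U `<=` S ->
    (forall x, W x -> S (f x)) -> (forall y, S y -> exists2 x, W x & U (y - f x)) ->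
  rlen K W l <-> rlen U S l.
Proof.
move=> hW hU hS KU KW US WS SW.
have -> : K = W `&` f @^-1` U.
  apply/seteqP; split=> x /=; last by case=> Wx /(KU _ Wx).
  by move=> Kx; have Wx := KW _ Kx; split=> //; apply/KU.
have -> : S = sumset U (f @` W).
  apply/seteqP; split; last by apply: sumset_min => // _ [x /WS ? <-].
  move=> y /SW[x Wx Uyx]; exists (y - f x) => //; exists x => //.
  by rewrite opprB addrC subrK.
exact: rlen_map.
Qed.

(** Two comparisons are composed: the projection from [submod W] onto the quotient, and the
    inclusion of [submod W] into V. The left side has the shape in which [Tor] is defined. *)
Lemma rlen_quotmod (R : pzRingType) (V : lmodType R) (U W : submodClosed V) l :
    (forall x, x \in U -> x \in W) ->
  has_length (quotmod (kerm (quotmod_pi U \o @submod_val _ _ W))) l <->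
  rlen [set x | x \in U] [set x | x \in W] l.
Proof.
move=> UW; set K := kerm _.
have KE (x : submod W) : x \in K <-> submod_val x \in U.
  rewrite -[X in X \in U]subr0 -quotmod_piP raddf0.
  by split=> [/eqP|?]; last apply/eqP.
rewrite has_lengthE -(@rlen_map_onto _ _ _ (quotmod_pi K) [set x | x \in K] setT) //.
- apply: (@rlen_map_onto _ _ _ (@submod_val _ _ W)) => //.
  + exact: submodset_closed.
  + exact: submodset_closed.
  + by move=> x _; exact: KE.
  + by move=> x _; case: x.
  + by move=> y Wy; exists (Submod Wy); rewrite //= subrr rpred0.
- exact: submodset_set0.
- move=> x _ /=; rewrite -[X in X \in K]subr0 -quotmod_piP raddf0.
  by split.
- by move=> y _; exists (repr y); rewrite //= quotmod_reprK subrr.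
Qed.

(** * Bigraded modules as families of submodules *)

Section GradedFamilies.
Variables (R : pzRingType) (V : lmodType R).

(* An operator of bidegree (a, b) is recorded as the triple (a, b, o). *)
Definition operators := seq (nat * nat * (V -> V)).

Definition good_ops (ops : operators) :=
  [/\ forall (a b : nat) (o : V -> V), (a, b, o) \in ops -> linear o,
      forall (a b : nat) (o : V -> V), (a, b, o) \in ops -> (0 < a + b)%N &
      forall (a b : nat) (o : V -> V) (a' b' : nat) (o' : V -> V),
        (a, b, o) \in ops -> (a', b', o') \in ops -> forall v, o (o' v) = o' (o v)].

Definition family := nat -> nat -> set V.

Definition stable (ops : operators) (U : family) :=
  (forall m n, submodset (U m n)) /\
  forall (a b : nat) (o : V -> V), (a, b, o) \in ops ->
    forall m n v, U m n v -> U (a + m)%N (b + n)%N (o v).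

(** The component in degree (m, n) of the submodule generated by H over the polynomial ring on
    [ops]. Generators carry their degrees because an element of V may belong to several
    components. *)
Inductive gen (ops : operators) (H : seq (nat * nat * V)) :
  nat -> nat -> V -> Prop :=
| gen_in m n v : (m, n, v) \in H -> gen ops H m n v
| gen0 m n : gen ops H m n 0
| genP m n a u v : gen ops H m n u -> gen ops H m n v -> gen ops H m n (a *: u + v)
| gen_op a b o m n v : (a, b, o) \in ops -> gen ops H m n v ->
    gen ops H (a + m) (b + n) (o v).

Definition subfam (U W : family) := forall m n, U m n `<=` W m n.

Definition sumfam (U W : family) : family := fun m n => sumset (U m n) (W m n).

Definition contains (U : family) (H : seq (nat * nat * V)) :=
  forall m n v, (m, n, v) \in H -> U m n v.

(** For stable V' and Z this says that V' / (V' [&] Z) is finitely generated; Z need not lie in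
    V'. *)
Definition fg_mod ops (V' Z : family) :=
  exists2 H, contains V' H & subfam V' (sumfam (gen ops H) Z).

Definition zerofam : family := fun _ _ => [set 0].

Lemma submodset_gen ops H m n : submodset (gen ops H m n).
Proof. by split; [apply: gen0 | move=> a x y; apply: genP]. Qed.

Lemma stable_gen ops H : stable ops (gen ops H).
Proof.
by split=> [m n|a b o oin m n v]; [exact: submodset_gen | exact: gen_op].
Qed.

Lemma gen_min ops H U : stable ops U -> contains U H -> subfam (gen ops H) U.
Proof.
move=> [hU oU] HU m n v; elim=> {m n v} [m n v /HU //|m n|m n a u v _ Uu _ Uv|].
- exact: submodset0.
- exact: submodsetP.
- by move=> a b o m n v oin _; apply: oU.
Qed.

Lemma gen_mono ops (ops' : operators) H (H' : seq (nat * nat * V)) :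
  {subset ops <= ops'} -> {subset H <= H'} ->
  subfam (gen ops H) (gen ops' H').
Proof.
move=> sops sH; apply: gen_min => [|m n v /sH]; last exact: gen_in.
split=> [m n|a b o /sops oin m n v]; first exact: submodset_gen.
exact: gen_op.
Qed.

Lemma stable_sub (ops ops' : operators) U : {subset ops' <= ops} -> stable ops U -> stable ops' U.
Proof. by move=> s [h1 h2]; split=> // a b o /s; apply: h2. Qed.

Lemma good_sub (ops ops' : operators) : {subset ops' <= ops} -> good_ops ops -> good_ops ops'.
Proof.
move=> s [h1 h2 h3]; split=> [a b o /s/h1//|a b o /s/h2//|].
by move=> a b o a' b' o' /s h /s; apply: h3 h.
Qed.

Lemma map0_linear (o : V -> V) : linear o -> o 0 = 0.
Proof. by move=> lo; have := lo (-1) 0 0; rewrite scaleN1r oppr0 addr0 scaleN1r addNr. Qed.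

Lemma mapD_linear (o : V -> V) : linear o -> forall u v, o (u + v) = o u + o v.
Proof. by move=> lo u v; have := lo 1 u v; rewrite !scale1r. Qed.

Lemma mapB_linear (o : V -> V) : linear o -> forall u v, o (u - v) = o u - o v.
Proof. by move=> lo u v; have := lo (-1) v u; rewrite !scaleN1r ![- _ + _]addrC. Qed.

Lemma stable_sumfam ops U W : good_ops ops -> stable ops U -> stable ops W ->
  stable ops (sumfam U W).
Proof.
move=> [lo _ _] [hU oU] [hW oW]; split=> [m n|a b o oin m n v [u Uu Wv]].
  exact: submodset_sumset.
by exists (o u); [apply: oU | rewrite -(mapB_linear (lo _ _ _ oin)); apply: oW].
Qed.

Lemma stable_zerofam ops : good_ops ops -> stable ops zerofam.
Proof.
move=> [lo _ _]; split=> [m n|a b o oin m n v ->]; first exact: submodset_set0.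
exact/map0_linear/lo/oin.
Qed.

Lemma stableI ops U W : stable ops U -> stable ops W ->
  stable ops (fun m n => U m n `&` W m n).
Proof.
move=> [hU oU] [hW oW]; split=> [m n|a b o oin m n v [Uv Wv]].
  exact: submodsetI.
by split; [apply: oU | apply: oW].
Qed.

Lemma stable_preimage ops (o : {linear V -> V}) a b U :
  (forall (a' b' : nat) (o' : V -> V), (a', b', o') \in ops -> forall v, o (o' v) = o' (o v)) ->
  stable ops U -> stable ops (fun m n => o @^-1` U (a + m)%N (b + n)%N).
Proof.
move=> co [hU oU]; split=> [m n|a' b' o' oin m n v /= Uv].
  exact: submodset_preimage.
by rewrite (co _ _ _ oin) !(addnCA _ a', addnCA _ b'); apply: oU.
Qed.

(* Multiplication by an operator t of bidegree (a, b) maps [shiftfam a b U] to U. *)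
Definition shiftfam a b (U : family) : family := fun m n =>
  if (a <= m)%N && (b <= n)%N then U (m - a)%N (n - b)%N else [set 0].

Lemma shiftfamE a b U m n : shiftfam a b U (a + m)%N (b + n)%N = U m n.
Proof. by rewrite /shiftfam !leq_addr !addKn. Qed.

Lemma stable_shiftfam ops a b U : good_ops ops -> stable ops U ->
  stable ops (shiftfam a b U).
Proof.
move=> [lo _ _] [hU oU]; split=> [m n|a' b' o oin m n v]; rewrite /shiftfam.
  by case: ifP => _; [exact: hU | exact: submodset_set0].
case: ifP => [/andP[am bn] Uv|_ ->]; last first.
  by rewrite (map0_linear (lo _ _ _ oin)); case: ifP => // _; apply: submodset0.
by rewrite !(leq_trans am, leq_trans bn, leq_addl) //= -!addnBA //; apply: oU.
Qed.

Definition imfam a b (t : V -> V) (U : family) : family :=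
  fun m n => [set t v | v in shiftfam a b U m n].

Lemma stable_imfam ops a b t U : good_ops ops -> linear t ->
  (forall (a' b' : nat) (o' : V -> V), (a', b', o') \in ops -> forall v, t (o' v) = o' (t v)) ->
  stable ops U -> stable ops (imfam a b t U).
Proof.
move=> gops lt ct /(stable_shiftfam a b gops) [hU oU].
split=> [m n|a' b' o oin m n _ [v Uv <-]].
  pose tl := GRing.isLinear.Build _ _ _ _ t lt.
  pose tL : {linear V -> V} := HB.pack t tl.
  exact: (@submodset_image _ _ _ tL).
by rewrite -(ct _ _ _ oin); exists (o v) => //; apply: oU.
Qed.

(** Modulo t W the operator t acts as zero, so the same generators suffice without it. *)
Lemma fg_mod_drop ops (ops' : operators) (a b : nat) (t : V -> V) W Z : good_ops ops ->
    (forall e, e \in ops -> e = (a, b, t) \/ e \in ops') ->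
    {subset ops' <= ops} -> (a, b, t) \in ops ->
    stable ops W -> stable ops Z -> fg_mod ops W Z ->
  fg_mod ops' W (sumfam Z (imfam a b t W)).
Proof.
move=> gops split_ops sops tin sW sZ [H HW WH].
have [lo _ co] := gops; have lt := lo _ _ _ tin.
have sI : stable ops (imfam a b t W).
  by apply: stable_imfam => // a' b' o' oin v; apply: (co _ _ _ _ _ _ tin oin).
exists H => //.
pose X : family := fun m n => sumset (gen ops' H m n) (imfam a b t W m n).
(* Membership in W is carried through the induction, because t sends only elements of W into
   [imfam a b t W]. *)
suff HX : subfam (gen ops H) (fun m n => W m n `&` X m n).
  move=> m n v /WH[w /HX[Ww [w0 gw0 iw]] Zvw]; exists w0 => //.
  by exists (v - w) => //; rewrite addrAC opprB addrCA subrr addr0.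
apply: gen_min => [|m n v vH]; last first.
  split; first exact: HW.
  by apply: sumsetl; [apply sI | exact: gen_in].
split=> [m n|a' b' o oin m n v [Wv [w0 gw0 iw]]].
  apply: submodsetI; first by apply sW.
  by apply: submodset_sumset; [exact: submodset_gen | apply sI].
split; first by apply sW.
case: (split_ops _ oin) => [[-> -> ->]|oin'].
  apply: sumsetr; first exact: submodset_gen.
  by exists v; rewrite ?shiftfamE.
exists (o w0); first exact: gen_op.
by rewrite -(mapB_linear (lo _ _ _ oin)); apply sI.
Qed.

End GradedFamilies.

Arguments zerofam {R V}.

(** * Hilbert's basis theorem for families *)

Lemma noetherian_set (R : comPzRingType) (hR : noetherian_ring R) (A : set R^o) :
  submodset A -> exists2 s : seq R^o, (forall a, a \in s -> A a) &
    forall P : set R^o, submodset P -> (forall a, a \in s -> P a) -> A `<=` P.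
Proof.
move=> hA; have [s sA] := hR (asub hA); exists s => [a ains|P hP sP a Aa].
  by have /asboolP : a \in asub hA by rewrite sA; apply: sub_span.
by apply: (span_minset hP sP); rewrite -sA; apply/asboolP.
Qed.

Lemma seq_choice (T : eqType) (V : Type) (v0 : V) (s : seq T) (P : T -> V -> Prop) :
  (forall x, x \in s -> exists y, P x y) ->
  exists f, forall x, x \in s -> P x (f x).
Proof.
move=> h; have /choice[f hf] : forall x, exists y, x \in s -> P x y.
  move=> x; have [/h[y Py]|] := boolP (x \in s); first by exists y.
  by exists v0.
by exists f.
Qed.

Section Noetherian.
Variables (R : comPzRingType) (hR : noetherian_ring R) (V : lmodType R).
Implicit Types (ops : operators V) (U W Z : family V).

Lemma gen_nil_cons m0 n0 g (G : seq (nat * nat * V)) m n v :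
  gen [::] ((m0, n0, g) :: G) m n v -> exists2 a : R,
    (m, n) = (m0, n0) \/ a = 0 & gen [::] G m n (v - a *: g).
Proof.
pose X : family V := fun m n v => exists2 a : R,
    (m, n) = (m0, n0) \/ a = 0 & gen [::] G m n (v - a *: g).
have sX : stable [::] X.
  split=> // {}m {}n; split; first by exists 0; [right | rewrite scale0r subr0; apply: gen0].
  move=> c x y [a ha gx] [b hb gy]; exists (c * a + b).
    case: ha => [|->]; first by left.
    by rewrite mulr0 add0r.
  by rewrite scalerDl -scalerA opprD addrACA -scalerBr; apply: genP.
apply: (gen_min sX) => {}m {}n {}v; rewrite inE => /orP[/eqP[-> -> ->]|vG].
  by exists 1; [left | rewrite scale1r subrr; apply: gen0].
by exists 0; [right | rewrite scale0r subr0; apply: gen_in].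
Qed.

(** Induction on the generators. The coefficients of g in elements of U, modulo the other generators
    and Z, form an ideal I, which is finitely generated. Lifts of its generators reduce an element
    of U to one with coefficient zero, where the induction hypothesis applies. *)
Lemma fg_mod_nil (G : seq (nat * nat * V)) U Z :
    stable [::] U -> stable [::] Z ->
  subfam U (sumfam (gen [::] G) Z) -> fg_mod [::] U Z.
Proof.
elim: G U => [|[[m0 n0] g] G IH] U sU sZ UGZ; first by exists [::].
pose GZ := sumfam (gen [::] G) Z.
have sGZ m n : submodset (GZ m n).
  by apply: submodset_sumset; [exact: submodset_gen | apply sZ].
pose I : set R^o := fun a => exists2 u, U m0 n0 u & GZ m0 n0 (u - a *: g).
have hI : submodset I.
  split; first by exists 0; [apply: submodset0; apply sU | rewrite scale0r subr0; apply: submodset0].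
  move=> c a b [u Uu Gu] [v Uv Gv]; exists (c *: u + v); first by apply: submodsetP => //; apply sU.
  rewrite scalerDl -[c *: a *: g]scalerA opprD addrACA -scalerBr; exact: submodsetP.
have [s sI Is] := noetherian_set hR hI.
have [h hh] : exists h : R^o -> V, forall a, a \in s ->
    U m0 n0 (h a) /\ GZ m0 n0 (h a - a *: g).
  by apply: (seq_choice 0 (P := fun a u => U m0 n0 u /\ GZ m0 n0 (u - a *: g))) => a /sI[u]; exists u.
pose U' : family V := fun m n => U m n `&` GZ m n.
have sU' : stable [::] U' by split=> // m n; apply: submodsetI; first by apply sU.
have [|H' H'U' UH'] := IH U' sU' sZ; first by move=> m n v [].
pose H := H' ++ [seq (m0, n0, h a) | a <- s].
have H'H : {subset H' <= H} by move=> e; rewrite mem_cat => ->.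
have UH m n v : U m n v -> GZ m n v -> sumfam (gen [::] H) Z m n v.
  move=> Uv Gv; have /UH'[w gw zw] : U' m n v by [].
  by exists w => //; apply: gen_mono gw.
exists H => [m n v|m n u Uu].
  rewrite mem_cat => /orP[/H'U'[]//|/mapP[a ains [-> -> ->]]].
  by have [] := hh a ains.
have [w /gen_nil_cons[a ha gw] zw] := UGZ _ _ _ Uu.
have Gua : GZ m n (u - a *: g).
  by exists (w - a *: g) => //; rewrite opprB addrA subrK.
case: ha => [[? ?]|a0]; last by apply: UH => //; rewrite a0 scale0r subr0 in Gua.
subst m n.
(* P consists of the coefficients realised by elements of U that H generates. It contains the
   generators of I, hence I, and therefore a. *)
pose P : set R^o := fun b => exists2 c, U m0 n0 c /\ gen [::] H m0 n0 c & GZ m0 n0 (c - b *: g).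
have hP : submodset P.
  split; first exists 0; first by split; [apply: submodset0; apply sU | apply: gen0].
    by rewrite scale0r subr0; apply: submodset0.
  move=> c b b' [u1 [Uu1 gu1] Gu] [v [Uv gv] Gv]; exists (c *: u1 + v).
    by split; [apply: submodsetP => //; apply sU | apply: genP].
  rewrite scalerDl -[c *: b *: g]scalerA opprD addrACA -scalerBr; exact: submodsetP.
have [|| c [Uc gc] Gc] := Is P hP _ a.
- move=> b bs; have [Ub Gb] := hh b bs; exists (h b) => //; split=> //.
  by apply: gen_in; rewrite mem_cat map_f ?orbT.
- by exists u.
have [||x gx Zx] := UH m0 n0 (u - c).
- by apply: submodsetB => //; apply sU.
- have -> : u - c = (u - a *: g) - (c - a *: g).
    by rewrite opprB addrA subrK.
  exact: submodsetB.
exists (x + c); last by rewrite opprD addrA addrAC.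
exact: (submodsetD (submodset_gen _ _ _ _)).
Qed.

(* The induction on the number of operators in Hilbert's basis theorem. For U inside W,
   the submodules L k of those v in W with t ^ k v in U + Z form an ascending chain,
   stable under the remaining operators, and W is finitely generated over these modulo
   Z' = Z + t W. Lifts to U of generators of L 0, ..., L K, where the chain is stationary
   modulo Z' from K on, generate U modulo Z: write v = w + t v' in L k with w generated,
   and continue with v' in L (k + 1), whose degree is smaller. *)
Section InductiveStep.
Variables (ops : operators V) (a b : nat) (t : V -> V).
Hypothesis gops : good_ops ((a, b, t) :: ops).
Hypothesis IH : forall Z W U, stable ops Z -> stable ops W -> stable ops U ->
  subfam U W -> fg_mod ops W Z -> fg_mod ops U Z.
Variables (Z W U : family V).
Hypotheses (sZ : stable ((a, b, t) :: ops) Z) (sW : stable ((a, b, t) :: ops) W)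
  (sU : stable ((a, b, t) :: ops) U) (UW : subfam U W)
  (fW : fg_mod ((a, b, t) :: ops) W Z).

Let opsS : {subset ops <= (a, b, t) :: ops}.
Proof. by move=> e eo; rewrite inE eo orbT. Qed.

Let lin_t : linear t.
Proof. by case: gops => lo _ _; apply: (lo a b); rewrite inE eqxx. Qed.

Let tin : (a, b, t) \in (a, b, t) :: ops.
Proof. by rewrite inE eqxx. Qed.

Let iter_linear k : linear (iter k t).
Proof. by elim: k => // k IHk c x y; rewrite /= IHk lin_t. Qed.

Let iter_comm k a' b' o v : (a', b', o) \in (a, b, t) :: ops ->
  iter k t (o v) = o (iter k t v).
Proof.
case: gops => _ _ co oin; elim: k => //= k ->.
exact: (co _ _ _ _ _ _ tin oin).
Qed.

Let Z' := sumfam Z (imfam a b t W).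

Let L k : family V := fun m n v => W m n v /\
  exists2 u, U (k * a + m)%N (k * b + n)%N u &
    Z (k * a + m)%N (k * b + n)%N (iter k t v - u).

Let iter_stable X k m n v : stable ((a, b, t) :: ops) X ->
  X m n v -> X (k * a + m)%N (k * b + n)%N (iter k t v).
Proof.
move=> [_ oX] Xv; elim: k => //= k IHk; rewrite !mulSn -!addnA.
exact: oX IHk.
Qed.

Let sub_L k m n : submodset (L k m n).
Proof.
have hW := sW.1 m n; have hU := sU.1 (k * a + m)%N (k * b + n)%N.
have hZ := sZ.1 (k * a + m)%N (k * b + n)%N.
split.
  split; first exact: submodset0.
  exists 0; first exact: (submodset0 hU).
  by rewrite (map0_linear (iter_linear k)) subrr; apply: (submodset0 hZ).
move=> c x y [Wx [u Uu Zu]] [Wy [v Uv Zv]]; split; first exact: submodsetP.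
exists (c *: u + v); first exact: submodsetP.
by rewrite iter_linear opprD addrACA -scalerBr; apply: submodsetP.
Qed.

Let stable_L k : stable ops (L k).
Proof.
split=> // a' b' o /opsS oin m n v [Wv [u Uu Zu]].
have lo : linear o by case: gops => lo _ _; exact: (lo a' b').
split; first by apply sW.
exists (o u); rewrite (addnCA _ a') (addnCA _ b'); first exact: sU.2 oin _ _ _ Uu.
by rewrite (iter_comm _ _ oin) -(mapB_linear lo); apply: sZ.2 oin _ _ _ Zu.
Qed.

Let L_succ k : subfam (L k) (L k.+1).
Proof.
move=> m n v [Wv [u Uu Zu]]; split=> //; exists (t u); rewrite !mulSn -!addnA.
  exact: sU.2 tin _ _ _ Uu.
by rewrite /= -(mapB_linear lin_t); apply: sZ.2 tin _ _ _ Zu.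
Qed.

Let L_le j k : (j <= k)%N -> subfam (L j) (L k).
Proof.
move=> /subnK <-; elim: (k - j)%N => [|i IHi] m n v; [by [] | move=> /IHi].
rewrite addSn; exact: L_succ.
Qed.

(** One finite H serves every j >= k: the lifts are chosen for t ^ k, and for larger j they are
    multiplied by t ^ (j - k). *)
Let lift_gens k (Hl : seq (nat * nat * V)) : contains (L k) Hl ->
  exists2 H, contains U H & forall j m n w, (k <= j)%N -> gen ops Hl m n w ->
    exists2 g, gen ((a, b, t) :: ops) H (j * a + m)%N (j * b + n)%N g &
      Z (j * a + m)%N (j * b + n)%N (iter j t w - g).
Proof.
move=> HL.
have [h hh] : exists h : nat * nat * V -> V, forall e, e \in Hl ->
    U (k * a + e.1.1)%N (k * b + e.1.2)%N (h e) /\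
    Z (k * a + e.1.1)%N (k * b + e.1.2)%N (iter k t e.2 - h e).
  apply: (seq_choice 0 (P := fun e u => U (k * a + e.1.1)%N (k * b + e.1.2)%N u /\
    Z (k * a + e.1.1)%N (k * b + e.1.2)%N (iter k t e.2 - u))).
  by move=> [[m n] v] /HL[_ [u]]; exists u.
pose H := [seq ((k * a + e.1.1)%N, (k * b + e.1.2)%N, h e) | e <- Hl].
exists H => [m n v /mapP[e eH [-> -> ->]]|j m n w kj]; first by have [] := hh e eH.
pose X : family V := fun m n w =>
    exists2 g, gen ((a, b, t) :: ops) H (j * a + m)%N (j * b + n)%N g &
      Z (j * a + m)%N (j * b + n)%N (iter j t w - g).
suff : subfam (gen ops Hl) X by apply.
apply: gen_min => [|{}m {}n v vH].
  split=> [m' n'|a' b' o /opsS oin m' n' v [g gg Zg]].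
    have hZ := sZ.1 (j * a + m')%N (j * b + n')%N; split.
      exists 0; first exact: gen0.
      by rewrite (map0_linear (iter_linear j)) subrr; apply: submodset0.
    move=> c x y [g gg Zg] [g' gg' Zg']; exists (c *: g + g'); first exact: genP.
    by rewrite iter_linear opprD addrACA -scalerBr; apply: submodsetP.
  have lo : linear o by case: gops => lo _ _; exact: (lo a' b').
  exists (o g); rewrite (addnCA _ a') (addnCA _ b'); first exact: gen_op.
  by rewrite (iter_comm _ _ oin) -(mapB_linear lo); apply: sZ.2 oin _ _ _ Zg.
have [Uh Zh] := hh _ vH; rewrite /= in Uh Zh.
rewrite /X -(subnK kj); set i := (j - k)%N.
exists (iter i t (h (m, n, v))).
  rewrite !mulnDl -!addnA; apply: iter_stable; first exact: stable_gen.
  by apply: gen_in; apply/mapP; exists (m, n, v).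
rewrite iterD -(mapB_linear (iter_linear i)) !mulnDl -!addnA.
exact: iter_stable.
Qed.

Let covered H k := forall m n v, L k m n v -> exists2 w,
  exists2 g, gen ((a, b, t) :: ops) H (k * a + m)%N (k * b + n)%N g &
      Z (k * a + m)%N (k * b + n)%N (iter k t w - g)
  & Z' m n (v - w).

Let covered_mono (H H' : seq (nat * nat * V)) k :
  {subset H <= H'} -> covered H k -> covered H' k.
Proof.
move=> HH c m n v /c[w [g gg Zg] Zw]; exists w => //; exists g => //.
by apply: gen_mono gg.
Qed.

Lemma fg_mod_step : fg_mod ((a, b, t) :: ops) U Z.
Proof.
have gops' := good_sub opsS gops.
have sZ' : stable ops Z'.
  apply: stable_sumfam => //; first exact: stable_sub sZ.
  apply: stable_imfam => //; last exact: stable_sub sW.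
  by move=> a' b' o oin v; apply: (iter_comm 1 v (opsS oin)).
have fW' : fg_mod ops W Z'.
  apply: (fg_mod_drop gops) => // e; rewrite inE => /orP[/eqP|]; by [left|right].
have LW k : subfam (L k) W by move=> m n v [].
have sW' := stable_sub opsS sW.
pose Linf : family V := fun m n v => exists k, L k m n v.
have sLinf : stable ops Linf.
  split=> [m n|a' b' o oin m n v [k Lv]]; last by exists k; apply: (stable_L k).2.
  split; first by exists 0%N; exact: (submodset0 (sub_L 0 m n)).
  move=> c x y [j Lx] [k Ly]; exists (maxn j k).
  apply: (submodsetP _ (sub_L (maxn j k) m n)).
    by apply: L_le Lx; apply: leq_maxl.
  by apply: L_le Ly; apply: leq_maxr.
have [] := IH sZ' sW' sLinf _ fW'; first by move=> m n v [k [Wv _]].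
move=> Hinf HinfL LHinf.
(* The union of the chain is finitely generated modulo Z', and its finitely many generators already
   lie in one L K. This is where the chain becomes stationary. *)
have [K HK] : exists K, contains (L K) Hinf.
  elim: Hinf HinfL {LHinf} => [|[[m n] v] s IHs] HL; first by exists 0%N.
  have [|j Lj] := IHs; first by move=> m' n' v' vs; apply: HL; rewrite inE vs orbT.
  have [|k Lk] := HL m n v; first by rewrite inE eqxx.
  exists (maxn j k) => m' n' v'; rewrite inE => /orP[/eqP[-> -> ->]|/Lj].
    by apply: L_le Lk; apply: leq_maxr.
  by apply: L_le; apply: leq_maxl.
have [H1 H1U cH1] : exists2 H, contains U H & forall k, (K <= k)%N -> covered H k.
  have [H HU Hj] := lift_gens HK; exists H => // k Kk m n v Lv.
  have [w gw Zw] : sumfam (gen ops Hinf) Z' m n v by apply: LHinf; exists k.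
  by exists w => //; apply: Hj gw.
have [H HU cH] : exists2 H, contains U H & forall k, covered H k.
  suff [H HU cH] : exists2 H, contains U H & forall k, (k < K)%N -> covered H k.
    exists (H ++ H1) => [m n v|k]; first by rewrite mem_cat => /orP[/HU|/H1U].
    have [/cH1|/cH] := leqP K k; apply: covered_mono => e eH;
      by rewrite mem_cat eH ?orbT.
  elim: (K) => [|k [H HU cH]]; first by exists [::].
  have [Hk HkL LHk] := IH sZ' sW' (stable_L k) (LW k) fW'.
  have [H2 H2U cH2] := lift_gens HkL.
  exists (H ++ H2) => [m n v|j]; first by rewrite mem_cat => /orP[/HU|/H2U].
  rewrite ltnS leq_eqVlt => /orP[/eqP->|/cH].
    move=> m n v /LHk[w gw Zw]; exists w => //.
    have [g gg Zg] := cH2 k m n w (leqnn _) gw; exists g => //.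
    by apply: gen_mono gg => // e eH; rewrite mem_cat eH orbT.
  by apply: covered_mono => e eH; rewrite mem_cat eH.
have abgt0 : (0 < a + b)%N by case: gops => _ pos _; apply: pos tin.
have gU : subfam (gen ((a, b, t) :: ops) H) U by apply: gen_min.
exists H => // m n u Uu.
suff D d : forall m n, (m + n <= d)%N -> forall k v, L k m n v ->
    exists2 g, gen ((a, b, t) :: ops) H (k * a + m)%N (k * b + n)%N g &
      Z (k * a + m)%N (k * b + n)%N (iter k t v - g).
  apply: (D (m + n)%N m n (leqnn _) 0%N u); split; first exact: UW.
  by exists u => //; rewrite subrr; exact: (submodset0 (sZ.1 _ _)).
clear m n u Uu.
elim/ltn_ind: d => d IHd m n mnd k v Lv.
have [w [g1 gg1 Zg1] [z Zz [v' Wv' v'E]]] := cH _ _ _ _ Lv.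
have vE : v = w + t v' + z by rewrite v'E -addrA subrK addrC subrK.
have [g2 gg2 Zg2] : exists2 g,
    gen ((a, b, t) :: ops) H (k * a + m)%N (k * b + n)%N g &
      Z (k * a + m)%N (k * b + n)%N (iter k.+1 t v' - g).
  (* Below degree (a, b) the shifted family is zero, so v' = 0 and the descent ends. *)
  move: Wv'; rewrite /shiftfam; case: ifP => [/andP[am bn]|_ ->]; last first.
    exists 0; first exact: gen0.
    by rewrite (map0_linear (iter_linear k.+1)) subrr; exact: (submodset0 (sZ.1 _ _)).
  move=> Wv'.
  have eqN c m' : (c <= m')%N -> (k * c + m' = k.+1 * c + (m' - c))%N.
    by move=> cm; rewrite mulSn addnAC subnKC // addnC.
  rewrite (eqN _ _ am) (eqN _ _ bn); apply: (IHd ((m - a) + (n - b))%N _) => //.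
    apply: leq_trans mnd; rewrite -{2}(subnK am) -{2}(subnK bn) addnACA.
    by rewrite -[X in (X < _)%N]addn0 ltn_add2l.
  (* To see that v' lies in L (k + 1), subtract from u', which represents t ^ k v modulo Z, the
     generated element g1 representing t ^ k w; the term t ^ k z lies in Z. *)
  split=> //; case: Lv => _ [u' Uu' Zu'].
  exists (u' - g1); rewrite -!eqN //; first by apply: submodsetB (gU _ _ _ gg1); first exact: sU.1.
  have -> : iter k.+1 t v' = iter k t v - iter k t w - iter k t z.
    by rewrite vE !(mapD_linear (iter_linear k)) iterSr [_ + iter k t (t v')]addrC addrAC addrK addrK.
  have hZ := sZ.1 (k * a + m)%N (k * b + n)%N.
  have -> : forall x y w' g : V, x - w' - y - (u' - g) = (x - u') - (w' - g) - y.
    move=> x y w' g; rewrite !opprB addrAC addrACA.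
    by rewrite [- w' - u']addrC addrACA.
  apply: submodsetB => //; last exact: iter_stable.
  exact: submodsetB.
exists (g1 + g2); first exact: (submodsetD (submodset_gen _ _ _ _)).
have hZ := sZ.1 (k * a + m)%N (k * b + n)%N.
rewrite vE !(mapD_linear (iter_linear k)) -iterSr opprD addrAC addrACA.
apply: submodsetD => //; last exact: iter_stable.
exact: submodsetD.
Qed.

End InductiveStep.

(** The statement is about modules from the start, so the polynomial ring on the operators is never
    built. It quantifies over Z because dropping t replaces Z by Z + t W. *)
Theorem fg_mod_sub ops Z W U : good_ops ops -> stable ops Z -> stable ops W ->
  stable ops U -> subfam U W -> fg_mod ops W Z -> fg_mod ops U Z.
Proof.
elim: ops Z W U => [|[[a b] t] ops IH] Z W U gops sZ sW sU UW fW.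
  by have [G _ WG] := fW; apply: (fg_mod_nil sU sZ (G := G)) => m n v Uv; apply: WG; apply: UW.
apply: (fg_mod_step gops _ sZ sW sU UW fW) => Z' W' U' sZ' sW' sU' UW' fW'.
apply: IH UW' fW' => //; apply: good_sub gops.
by move=> e eo; rewrite inE eo orbT.
Qed.
End Noetherian.

(** * Eventually polynomial functions *)

Section EventuallyPolynomial.
Implicit Types (f g : nat -> nat -> rat) (s : seq (rat * (nat * nat))).

(* The binomial basis is used because summation in m only shifts it. *)
Definition binform s m n : rat :=
  \sum_(t <- s) t.1 * 'C(m, t.2.1)%:R * 'C(n, t.2.2)%:R.

Definition evpoly f := exists s m0 n0, forall m n,
  (m0 <= m)%N -> (n0 <= n)%N -> f m n = binform s m n.

Lemma binform_cat s s' m n :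
  binform (s ++ s') m n = binform s m n + binform s' m n.
Proof. exact: big_cat. Qed.

Lemma binform_map (h : rat * (nat * nat) -> rat * (nat * nat)) s m n :
  binform [seq h t | t <- s] m n =
  \sum_(t <- s) (h t).1 * 'C(m, (h t).2.1)%:R * 'C(n, (h t).2.2)%:R.
Proof. exact: big_map. Qed.

Lemma binform_opp s : exists s', forall m n, binform s' m n = - binform s m n.
Proof.
exists [seq (- t.1, t.2) | t <- s] => m n.
by rewrite binform_map -sumrN; apply: eq_bigr => t _; rewrite /= !mulNr.
Qed.

Lemma binform_swap s : exists s', forall m n, binform s' m n = binform s n m.
Proof.
exists [seq (t.1, (t.2.2, t.2.1)) | t <- s] => m n.
by rewrite binform_map; apply: eq_bigr => t _; rewrite /= mulrAC.
Qed.

Lemma binform_shift s : exists s', forall m n, binform s' m n = binform s m.+1 n.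
Proof.
(* The extra term in Pascal's rule gets coefficient 0 when the lower index is 0, where the
   predecessor would leave the index unchanged. *)
exists ([seq (if t.2.1 is a.+1 then t.1 else 0, (t.2.1.-1, t.2.2)) | t <- s] ++ s).
move=> m n; rewrite binform_cat binform_map -big_split; apply: eq_bigr => -[c [[|a] b]] _ /=.
  by rewrite !bin0 !mul0r add0r.
by rewrite binS natrD mulrDr mulrDl addrC.
Qed.

(** By Pascal's rule, raising the lower index by one gives an antidifference. *)
Lemma binform_sum s : exists s',
  forall m n, binform s' m.+1 n - binform s' m n = binform s m n.
Proof.
exists [seq (t.1, (t.2.1.+1, t.2.2)) | t <- s] => m n.
rewrite !binform_map -sumrB; apply: eq_bigr => -[c [a b]] _ /=.
by rewrite binS natrD mulrDr mulrDl addrC addKr.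
Qed.

Lemma binform_freeze s k : exists s', forall m n, binform s' m n = binform s k n.
Proof.
exists [seq (t.1 * 'C(k, t.2.1)%:R, (0%N, t.2.2)) | t <- s] => m n.
by rewrite binform_map; apply: eq_bigr => t _; rewrite /= bin0 mulr1.
Qed.

Lemma evpoly_eq f g m0 n0 : (forall m n, (m0 <= m)%N -> (n0 <= n)%N ->
  f m n = g m n) -> evpoly g -> evpoly f.
Proof.
move=> fg [s [m1 [n1 gs]]]; exists s, (maxn m0 m1), (maxn n0 n1) => m n.
by rewrite !geq_max => /andP[? ?] /andP[? ?]; rewrite fg // gs.
Qed.

Lemma evpoly_const c : evpoly (fun _ _ => c).
Proof.
exists [:: (c, (0, 0))]%N, 0%N, 0%N => m n _ _.
by rewrite /binform big_seq1 /= !bin0 !mulr1.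
Qed.

Lemma evpolyD f g : evpoly f -> evpoly g -> evpoly (fun m n => f m n + g m n).
Proof.
move=> [s [m0 [n0 fs]]] [s' [m1 [n1 gs]]].
exists (s ++ s'), (maxn m0 m1), (maxn n0 n1) => m n.
by rewrite !geq_max binform_cat => /andP[? ?] /andP[? ?]; rewrite fs // gs.
Qed.

Lemma evpolyN f : evpoly f -> evpoly (fun m n => - f m n).
Proof.
move=> [s [m0 [n0 fs]]]; have [s' s'E] := binform_opp s.
by exists s', m0, n0 => m n mm nn; rewrite s'E fs.
Qed.

Lemma evpoly_swap f : evpoly f -> evpoly (fun m n => f n m).
Proof.
move=> [s [m0 [n0 fs]]]; have [s' s'E] := binform_swap s.
by exists s', n0, m0 => m n mm nn; rewrite s'E fs.
Qed.

Lemma evpoly_shift f : evpoly f -> evpoly (fun m n => f m.+1 n).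
Proof.
move=> [s [m0 [n0 fs]]]; have [s' s'E] := binform_shift s.
by exists s', m0, n0 => m n mm nn; rewrite s'E fs // leqW.
Qed.

(** Summing the differences from a base point M leaves the initial value f M n, whose polynomiality
    in n is the last hypothesis. *)
Lemma evpoly_sum f g m0 n0 : evpoly g ->
    (forall m n, (m0 <= m)%N -> (n0 <= n)%N -> f m.+1 n - f m n = g m n) ->
    (exists m1, forall m, (m1 <= m)%N -> evpoly (fun _ n => f m n)) ->
  evpoly f.
Proof.
move=> [s [m1 [n1 gs]]] fg [m2 fm]; have [S SE] := binform_sum s.
pose M := maxn m0 (maxn m1 m2).
have [M0 [M1 M2]] : (m0 <= M)%N /\ (m1 <= M)%N /\ (m2 <= M)%N.
  by rewrite /M !leq_max !leqnn !orbT.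
pose N := maxn n0 n1.
have fS m n : (M <= m)%N -> (N <= n)%N ->
    f m n = f M n + (binform S m n - binform S M n).
  move=> /subnK <-; rewrite geq_max => /andP[nn0 nn1].
  elim: (m - M)%N => [|k IH]; first by rewrite subrr addr0.
  have := fg (k + M)%N n (leq_trans M0 (leq_addl _ _)) nn0.
  rewrite gs ?(leq_trans M1 (leq_addl _ _)) // -SE => /eqP.
  rewrite subr_eq IH addSn => /eqP ->; rewrite addrCA; congr (_ + _).
  by rewrite addrA subrK.
apply: evpoly_eq fS _; apply: evpolyD; first exact: fm.
have [S' S'E] := binform_freeze S M.
apply: (evpolyD (g := fun m n => - binform S M n)).
  by exists S, 0%N, 0%N.
by apply: evpolyN; exists S', 0%N, 0%N => m n _ _; rewrite S'E.
Qed.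

(** The difference in n is needed only for fixed m, where it makes the initial values polynomial for
    the summation in m. *)
Lemma evpoly_diff f g h m0 n0 : evpoly g -> evpoly h ->
    (forall m n, (m0 <= m)%N -> (n0 <= n)%N -> f m.+1 n - f m n = g m n) ->
    (forall m n, (m0 <= m)%N -> (n0 <= n)%N -> f m n.+1 - f m n = h m n) ->
  evpoly f.
Proof.
move=> eg [s [m1 [n1 hs]]] fg fh; apply: evpoly_sum eg fg _.
exists (maxn m0 m1) => m; rewrite geq_max => /andP[mm0 mm1].
have [s' s'E] := binform_freeze s m.
have eh : evpoly (fun n _ : nat => h m n).
  apply: evpoly_swap; exists s', 0%N, n1 => m' n _ nn1.
  by rewrite s'E hs.
apply: evpoly_swap; apply: (evpoly_sum (m0 := n0) (n0 := 0%N) eh) => [n _ nn _|].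
  exact: fh.
by exists 0%N => n _; apply: evpoly_const.
Qed.

Lemma binform_mpoly s : exists p : {mpoly rat[2]}, forall m n,
  binform s m n = p.@[fun k : 'I_2 => if k == ord0 then m%:R else n%:R].
Proof.
pose bin (i : 'I_2) a : {mpoly rat[2]} :=
  ((a`!)%:R^-1 : rat) *: \prod_(k < a) ('X_i - (k%:R)%:MP).
have binE i a m (v : 'I_2 -> rat) : v i = m%:R -> (bin i a).@[v] = 'C(m, a)%:R.
  move=> vi; have fn0 : (a`!)%:R != 0 :> rat by rewrite Num.Theory.pnatr_eq0 -lt0n fact_gt0.
  apply: (mulfI fn0); rewrite mevalZ mulrA mulfV // mul1r -natrM mulnC bin_ffact.
  rewrite rmorph_prod ffact_prod natr_prod /=.
  under eq_bigr do rewrite mevalB mevalXU mevalC vi.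
  (* For m < a both products contain a zero factor at k = m, so truncated subtraction does no
     harm. *)
  have [am|ma] := leqP a m.
    by apply: eq_bigr => k _; rewrite natrB // ltnW // (leq_trans (ltn_ord k)).
  rewrite (bigD1 (Ordinal ma)) //= subrr mul0r.
  by rewrite (bigD1 (Ordinal ma)) //= subnn mul0r.
exists (\sum_(t <- s) t.1 *: (bin ord0 t.2.1 * bin ord_max t.2.2)) => m n.
rewrite raddf_sum; apply: eq_bigr => t _ /=.
by rewrite mevalZ mevalM (binE _ _ m) // (binE _ _ n) // mulrA.
Qed.

End EventuallyPolynomial.

(** * Hilbert polynomials of bigraded modules *)

Section HilbertFunction.
Variables (R : comPzRingType) (hR : noetherian_ring R) (V : lmodType R).
Implicit Types (ops : operators V) (U W Z : family V).

Definition lenfam U W m n : nat := len (U m n) (W m n).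

Definition evfinite U W := exists m0 n0, forall m n,
  (m0 <= m)%N -> (n0 <= n)%N -> rfin (U m n) (W m n).

Lemma fg_mod_mono ops W Z Z' : subfam Z Z' -> fg_mod ops W Z -> fg_mod ops W Z'.
Proof.
move=> ZZ [H HW WH]; exists H => // m n v /WH[w gw Zw].
by exists w => //; apply: ZZ.
Qed.

(** A degree that no operator raises is bounded on everything generated by finitely many elements.
    It is applied to the index of a list of operators that is empty. *)
Lemma gen_degree_bound (deg : nat -> nat -> nat) ops (H : seq (nat * nat * V)) :
    good_ops ops ->
    (forall (a b : nat) (o : V -> V), (a, b, o) \in ops ->
       forall m n, deg (a + m)%N (b + n)%N = deg m n) ->
  exists d, forall m n v, (d <= deg m n)%N -> gen ops H m n v -> v = 0.
Proof.
move=> [lo _ _] deg_ops.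
have [d Hd] : exists d, forall m n v, (m, n, v) \in H -> (deg m n < d)%N.
  elim: H => [|[[m n] v] H [d Hd]]; first by exists 0%N.
  exists (maxn (deg m n).+1 d) => m' n' v'; rewrite inE leq_max.
  by case/orP=> [/eqP[-> -> _]|/Hd ->]; rewrite ?leqnn ?orbT.
exists d => m n v dmn gv.
pose X : family V := fun m n => if (deg m n < d)%N then setT else [set 0].
suff /(_ _ _ _ gv) : subfam (gen ops H) X by rewrite /X ltnNge dmn.
apply: gen_min => [|m' n' v' /Hd]; last by rewrite /X => ->.
split=> [m' n'|a b o oin m' n' v'].
  by rewrite /X; case: ifP => _; [exact: submodset_setT | exact: submodset_set0].
rewrite /X (deg_ops _ _ _ oin); case: ifP => // _ ->.
by rewrite (map0_linear (lo _ _ _ oin)).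
Qed.

Lemma rlen_id (A : set V) : rlen A A 0.
Proof.
split=> [|[|k]] //= [T [_ AT nTA /rchain_sub TA]]; by case: nTA.
Qed.

(* The kernel K / U and the cokernel W / U' of t on W / U are annihilated by t, so the
   operator t can be dropped. *)
Section Step.
Variables (ops ops' : operators V) (a b : nat) (t : V -> V).
Hypotheses (gops : good_ops ops) (tin : (a, b, t) \in ops)
  (split_ops : forall e, e \in ops -> e = (a, b, t) \/ e \in ops')
  (sops : {subset ops' <= ops}).
Variables (U W : family V).
Hypotheses (sU : stable ops U) (sW : stable ops W) (UW : subfam U W)
  (fW : fg_mod ops W U).

Let K : family V := fun m n => W m n `&` t @^-1` U (a + m)%N (b + n)%N.
Let U' := sumfam U (imfam a b t W).

Lemma hilbert_step : exists K U' : family V,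
  [/\ [/\ stable ops K, subfam U K & fg_mod ops' K U],
      [/\ stable ops U', subfam U' W & fg_mod ops' W U'] &
    forall m0 n0,
      (forall m n, (m0 <= m)%N -> (n0 <= n)%N -> rfin (U m n) (W m n)) ->
      forall m n, (m0 <= m)%N -> (n0 <= n)%N ->
      [/\ rfin (U m n) (K m n), rfin (U' m n) (W m n) &
        (lenfam U W (a + m) (b + n) + lenfam U K m n =
         lenfam U W m n + lenfam U' W (a + m) (b + n))%N]].
Proof.
have [lo _ co] := gops; have lt := lo _ _ _ tin.
pose tl := GRing.isLinear.Build _ _ _ _ t lt.
pose tL : {linear V -> V} := HB.pack t tl.
have ct (a' b' : nat) (o' : V -> V) : (a', b', o') \in ops ->
    forall v, t (o' v) = o' (t v).
  by move=> oin v; apply: (co _ _ _ _ _ _ tin oin).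
have sK : stable ops K by apply: stableI => //; exact: (@stable_preimage _ _ _ tL).
have sI : stable ops (imfam a b t W) by apply: stable_imfam.
have sU' : stable ops U' by apply: stable_sumfam.
have UK : subfam U K.
  by move=> m n v Uv; split; [exact: UW | exact: sU.2 tin _ _ _ Uv].
have KW : subfam K W by move=> m n v [].
have UU' : subfam U U' by move=> m n; apply: sumsetl; apply: sI.1.
have U'W : subfam U' W.
  move=> m n; apply: sumset_min; [exact: sW.1 | exact: UW | move=> _ [v + <-]].
  rewrite /shiftfam; case: ifP => [/andP[am bn] Wv|_ ->].
    by rewrite -(subnKC am) -(subnKC bn); apply: sW.2.
  by rewrite (map0_linear lt); exact: (submodset0 (sW.1 _ _)).
have fK : fg_mod ops' K U.
  have := fg_mod_drop gops split_ops sops tin sK sU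
    (fg_mod_sub hR gops sU sW sK KW fW).
  apply: fg_mod_mono => m n; apply: sumset_min => //; first exact: sU.1.
  move=> _ [v + <-]; rewrite /shiftfam; case: ifP => [/andP[am bn] [_]|_ ->].
    by rewrite /= !subnKC.
  by rewrite (map0_linear lt); exact: (submodset0 (sU.1 _ _)).
exists K, U'; split; [by [] | by split=> //; exact: (fg_mod_drop gops split_ops sops tin sW sU fW) |].
move=> m0 n0 fin m n m0m n0n.
have fin1 := fin _ _ m0m n0n.
have fin2 := fin _ _ (leq_trans m0m (leq_addl a m)) (leq_trans n0n (leq_addl b n)).
have [f1 f2 l1] := rlen_add (sU.1 m n) (sK.1 m n) (sW.1 m n) (UK m n) (KW m n) fin1.
have [_ f2' _] := rlen_add (sU.1 _ _) (sU'.1 _ _) (sW.1 _ _) (UU' _ _) (U'W _ _) fin1.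
have [f3 f4 l2] :=
  rlen_add (sU.1 _ _) (sU'.1 _ _) (sW.1 _ _) (UU' _ _) (U'W _ _) fin2.
split=> //; rewrite /lenfam l1 l2.
(* Multiplication by t identifies W / K in degree (m, n) with U' / U in degree (a + m, b + n). *)
have -> : len (U (a + m)%N (b + n)%N) (U' (a + m)%N (b + n)%N) = len (K m n) (W m n).
  apply: lenE; have := lenP f2.
  rewrite (rlen_map tL (sW.1 m n) (sU.1 (a + m)%N (b + n)%N)).
  by rewrite /U' /sumfam /imfam shiftfamE.
by rewrite addnC addnA.
Qed.

End Step.

Definition bigraded_ops (xs ys : seq (V -> V)) : operators V :=
  [seq (1%N, 0%N, x) | x <- xs] ++ [seq (0%N, 1%N, y) | y <- ys].

(** The exact sequences of kernel and cokernel for one x and one y express both differences of the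
    length through cases with one operator less. Both differences are required, so the induction
    stops as soon as either list is empty; W / U then vanishes once the corresponding index is
    large. *)
Theorem hilbert_polynomial xs ys U W :
    good_ops (bigraded_ops xs ys) ->
    stable (bigraded_ops xs ys) U -> stable (bigraded_ops xs ys) W ->
    subfam U W -> fg_mod (bigraded_ops xs ys) W U -> evfinite U W ->
  evpoly (fun m n => (lenfam U W m n)%:R).
Proof.
have [k] := ubnP (size xs + size ys)%N.
elim: k xs ys U W => // k IH xs ys U W le_k gops sU sW UW fW fin.
have zero m1 n1 : (forall m n, (m1 <= m)%N -> (n1 <= n)%N -> W m n `<=` U m n) ->
    evpoly (fun m n => (lenfam U W m n)%:R).
  move=> WU; apply: (@evpoly_eq _ (fun _ _ => 0) m1 n1); last exact: evpoly_const.
  move=> m n m1m n1n; have /seteqP : (U m n `<=` W m n) /\ (W m n `<=` U m n).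
    by split; [exact: UW | exact: WU].
  by rewrite /lenfam => ->; rewrite (lenE (rlen_id _)).
case: xs => [|x xs] in le_k gops sU sW fW *.
  have [H _ WH] := fW.
  have [|M HM] := gen_degree_bound (deg := fun m _ => m) H gops.
    by move=> a b o; rewrite /bigraded_ops /= => /mapP[y _ [-> _ _]] m n.
  apply: (zero M 0%N) => m n Mm _ v /WH[w /(HM _ _ _ Mm)->].
  by rewrite subr0.
case: ys => [|y ys] in le_k gops sU sW fW *.
  have [H _ WH] := fW.
  have [|M HM] := gen_degree_bound (deg := fun _ n => n) H gops.
    by move=> a b o; rewrite /bigraded_ops cats0 => /mapP[z _ [_ -> _]] m n.
  apply: (zero 0%N M) => m n _ Mm v /WH[w /(HM _ _ _ Mm)->].
  by rewrite subr0.
set ops := bigraded_ops _ _ in gops sU sW fW.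
have sub1 : {subset bigraded_ops xs (y :: ys) <= ops}.
  by move=> e eo; rewrite /ops /bigraded_ops /= inE; apply/orP; right.
have sub2 : {subset bigraded_ops (x :: xs) ys <= ops}.
  move=> e; rewrite /ops /bigraded_ops !mem_cat /= [_ \in _ :: map _ ys]inE.
  by case/orP=> ->; rewrite ?orbT.
have in1 : (1%N, 0%N, x) \in ops by rewrite /ops /bigraded_ops inE eqxx.
have in2 : (0%N, 1%N, y) \in ops.
  by rewrite /ops /bigraded_ops mem_cat /= [_ \in _ :: map _ ys]inE eqxx orbT.
have split1 e : e \in ops -> e = (1%N, 0%N, x) \/ e \in bigraded_ops xs (y :: ys).
  by rewrite /ops /bigraded_ops /= inE => /orP[/eqP|]; [left|right].
have split2 e : e \in ops -> e = (0%N, 1%N, y) \/ e \in bigraded_ops (x :: xs) ys.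
  rewrite /ops /bigraded_ops !mem_cat [in map _ (y :: ys)]/= [_ \in _ :: map _ ys]inE.
  by case/or3P=> [->|/eqP|->]; rewrite ?orbT; [right | left | right].
have [m0 [n0 fin0]] := fin.
have le1 : (size xs + size (y :: ys) < k)%N by move: le_k; rewrite /= addSn ltnS.
have le2 : (size (x :: xs) + size ys < k)%N by move: le_k; rewrite /= addnS ltnS.
have [K1 [U1 [[sK1 UK1 fK1] [sU1 UW1 fW1] E1]]] := hilbert_step gops in1 split1 sub1 sU sW UW fW.
have [K2 [U2 [[sK2 UK2 fK2] [sU2 UW2 fW2] E2]]] := hilbert_step gops in2 split2 sub2 sU sW UW fW.
have gops1 := good_sub sub1 gops; have gops2 := good_sub sub2 gops.
have p1 : evpoly (fun m n => (lenfam U K1 m n)%:R).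
  apply: (IH _ _ _ _ le1 gops1) => //; try exact: stable_sub sub1 _.
  by exists m0, n0 => m n mm nn; have [] := E1 _ _ fin0 m n mm nn.
have p1' : evpoly (fun m n => (lenfam U1 W m n)%:R).
  apply: (IH _ _ _ _ le1 gops1) => //; try exact: stable_sub sub1 _.
  by exists m0, n0 => m n mm nn; have [] := E1 _ _ fin0 m n mm nn.
have p2 : evpoly (fun m n => (lenfam U K2 m n)%:R).
  apply: (IH _ _ _ _ le2 gops2) => //; try exact: stable_sub sub2 _.
  by exists m0, n0 => m n mm nn; have [] := E2 _ _ fin0 m n mm nn.
have p2' : evpoly (fun m n => (lenfam U2 W m n)%:R).
  apply: (IH _ _ _ _ le2 gops2) => //; try exact: stable_sub sub2 _.
  by exists m0, n0 => m n mm nn; have [] := E2 _ _ fin0 m n mm nn.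
have key (p q r s : nat) : (p + q = r + s)%N -> p%:R - r%:R = s%:R - q%:R :> rat.
  move=> /(congr1 (fun n => n%:R : rat)); rewrite !natrD => /(canRL (addrK _)) ->.
  by rewrite addrAC [r%:R + _]addrC addrK.
apply: (@evpoly_diff _ (fun m n => (lenfam U1 W m.+1 n)%:R - (lenfam U K1 m n)%:R)
  (fun m n => (lenfam U2 W m n.+1)%:R - (lenfam U K2 m n)%:R) m0 n0).
- by apply: evpolyD (evpolyN p1); exact: evpoly_shift p1'.
- apply: evpolyD (evpolyN p2).
  exact: (evpoly_swap (evpoly_shift (evpoly_swap p2'))).
- by move=> m n mm nn; apply: key; have [_ _] := E1 _ _ fin0 m n mm nn.
- by move=> m n mm nn; apply: key; have [_ _] := E2 _ _ fin0 m n mm nn.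
Qed.

End HilbertFunction.

(** * Homology of a complex modulo powers of an ideal *)

Section IdealAction.
Variables (R : comPzRingType) (bs : seq R).

(* The product of U and the ideal generated by bs. *)
Definition bmul (V : lmodType R) (U : set V) : set V := fun v =>
  forall W, submodset W -> (forall b u, b \in bs -> U u -> W (b *: u)) -> W v.

Definition bpow (V : lmodType R) m (U : set V) : set V := iter m (@bmul V) U.

Section OneModule.
Variable V : lmodType R.
Implicit Types U W : set V.

Lemma submodset_bmul U : submodset (bmul U).
Proof.
split=> [W hW _|a x y Ux Uy W hW UW]; first exact: submodset0.
by apply: submodsetP => //; [apply: Ux | apply: Uy].
Qed.

Lemma bmul_in U b u : b \in bs -> U u -> bmul U (b *: u).
Proof. by move=> bin Uu W _; apply. Qed.

Lemma submodset_bpow m U : submodset U -> submodset (bpow m U).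
Proof. by case: m => // m _; apply: submodset_bmul. Qed.

Lemma bpow_succ m U : submodset U -> bpow m.+1 U `<=` bpow m U.
Proof.
move=> hU v; apply; first exact: submodset_bpow.
by move=> b u _; apply: submodsetZ; exact: submodset_bpow.
Qed.

Lemma bpow_sub m U : submodset U -> bpow m U `<=` U.
Proof.
by move=> hU; elim: m => // m IH; apply: subset_trans IH; apply: bpow_succ.
Qed.

End OneModule.

Lemma bpow_linear (V W : lmodType R) (f : {linear V -> W}) m (U : set V) (U' : set W) :
  (forall u, U u -> U' (f u)) -> forall v, bpow m U v -> bpow m U' (f v).
Proof.
move=> fU; elim: m => //= m IH v bv.
apply: (bv (f @^-1` bmul (bpow m U'))); first exact/submodset_preimage/submodset_bmul.
by move=> b u bin Uu /=; rewrite linearZ; apply: bmul_in => //; apply: IH.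
Qed.

End IdealAction.

Section HomologyLength.
Variables (R : comPzRingType) (hR : noetherian_ring R) (T : lmodType R).
Variables (xs : seq (T -> T)) (bs : seq R).
Hypotheses (lin_xs : forall x, x \in xs -> linear x)
  (comm_xs : forall x y, x \in xs -> y \in xs -> forall v, x (y v) = y (x v)).

(* The identity in degree (1, 0) turns a family constant in the first index, that is a
   singly graded module, into a bigraded one. *)
Definition const_ops := bigraded_ops [:: id] xs.
Definition ideal_ops := bigraded_ops [seq ( *:%R b : T -> T) | b <- bs] xs.

Let bigraded_opsP (ys : seq (T -> T)) (a b : nat) (o : T -> T) :
  (a, b, o) \in bigraded_ops ys xs ->
  [/\ a = 1%N, b = 0%N & o \in ys] \/ [/\ a = 0%N, b = 1%N & o \in xs].
Proof.
by rewrite mem_cat => /orP[] /mapP[z zin [-> -> ->]]; [left | right].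
Qed.

Let good_bigraded (ys : seq (T -> T)) :
  (forall y, y \in ys -> linear y) ->
  (forall y z, y \in ys -> z \in ys -> forall v, y (z v) = z (y v)) ->
  (forall y x, y \in ys -> x \in xs -> forall v, y (x v) = x (y v)) ->
  good_ops (bigraded_ops ys xs).
Proof.
move=> lin_ys comm_ys comm_yx; split.
- by move=> a b o /bigraded_opsP[][_ _ h]; [exact: (lin_ys _ h) | exact: (lin_xs h)].
- by move=> a b o /bigraded_opsP[][-> ->].
- move=> a b o a' b' o' /bigraded_opsP[][_ _ h] /bigraded_opsP[][_ _ h'] v.
  + exact: (comm_ys _ _ h h').
  + exact: (comm_yx _ _ h h').
  + by rewrite (comm_yx _ _ h' h).
  + exact: (comm_xs h h').
Qed.

Lemma good_const_ops : good_ops const_ops.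
Proof. by apply: good_bigraded => [y|y z|y x]; rewrite inE => /eqP ->. Qed.

Lemma good_ideal_ops : good_ops ideal_ops.
Proof.
apply: good_bigraded => [y /mapP[b _ ->]|y z /mapP[b _ ->] /mapP[c _ ->] v|].
- by move=> a u v; rewrite scalerDr !scalerA mulrC.
- by rewrite !scalerA mulrC.
- move=> y x /mapP[b _ ->] /lin_xs lx v.
  by rewrite -[b *: v]addr0 lx (map0_linear lx) addr0.
Qed.

Definition const_fam (C : nat -> set T) : family T := fun _ => C.

Lemma const_opsP (U : nat -> set T) :
  (forall n, submodset (U n)) ->
  (forall x n v, x \in xs -> U n v -> U n.+1 (x v)) ->
  stable const_ops (const_fam U) /\ stable ideal_ops (const_fam U).
Proof.
move=> hU xU; split; split=> // a b o /bigraded_opsP[][-> -> oin] m n v Uv.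
- by move: oin; rewrite inE => /eqP ->.
- exact: xU.
- by move: oin => /mapP[c _ ->]; apply: submodsetZ.
- exact: xU.
Qed.

Section StableConst.
Variables (C : nat -> set T).
Hypotheses (hC : forall n, submodset (C n))
  (xC : forall x n v, x \in xs -> C n v -> C n.+1 (x v)).

Lemma xs_bpow m x n v : x \in xs -> bpow bs m (C n) v -> bpow bs m (C n.+1) (x v).
Proof.
move=> xin; pose tl := GRing.isLinear.Build _ _ _ _ x (lin_xs xin).
pose xL : {linear T -> T} := HB.pack x tl.
by apply: (bpow_linear (f := xL)) => u Cu; apply: xC.
Qed.

Lemma stable_bpow : stable ideal_ops (fun m n => bpow bs m (C n)).
Proof.
split=> [m n|a b o]; first exact: submodset_bpow.
move=> /bigraded_opsP[][-> -> oin] m n v Cv; last exact: xs_bpow.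
by move: oin Cv => /mapP[c cin ->] Cv; apply: bmul_in.
Qed.

Lemma fg_bpow : fg_mod const_ops (const_fam C) zerofam ->
  fg_mod ideal_ops (fun m n => bpow bs m (C n)) zerofam.
Proof.
move=> [H HC CH].
(* Generators are moved to first degree 0: in the constant family this index carries no information,
   and J ^ m C is reached from C by m factors from [bs]. *)
pose H' := [seq (0%N, h.1.2, h.2) | h <- H].
exists H' => [m n v /mapP[[[m' n'] h] hH [-> -> ->]]|m n v]; first exact: HC hH.
suff gH : bpow bs m (C n) `<=` gen ideal_ops H' m n.
  by move=> /gH gv; exists v => //; rewrite subrr.
elim: m => [{}v Cv|m IH {}v]; last first.
  apply; first exact: submodset_gen.
  move=> b u bin /IH gu; rewrite -[n]add0n -add1n; apply: gen_op gu.
  by rewrite mem_cat map_f // map_f.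
have [w gw /subr0_eq ->] := CH 0%N n v Cv.
suff /(_ _ _ _ gw) : subfam (gen const_ops H) (const_fam (gen ideal_ops H' 0)) by [].
apply: gen_min => [|m' n' h hH]; last by apply: gen_in; apply/mapP; exists (m', n', h).
apply: (const_opsP _ _).1 => [k|x k u xin gu]; first exact: submodset_gen.
by apply: (gen_op (a := 0) (b := 1)) gu; rewrite mem_cat map_f ?orbT.
Qed.

End StableConst.

Variables (D1 D2 : {linear T -> T}) (C2 C C' : nat -> set T).
Hypotheses (hC2 : forall n, submodset (C2 n)) (hC : forall n, submodset (C n))
  (hC' : forall n, submodset (C' n))
  (xC2 : forall x n v, x \in xs -> C2 n v -> C2 n.+1 (x v))
  (xC : forall x n v, x \in xs -> C n v -> C n.+1 (x v))
  (xC' : forall x n v, x \in xs -> C' n v -> C' n.+1 (x v))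
  (fgC : fg_mod const_ops (const_fam C) zerofam)
  (fgC' : fg_mod const_ops (const_fam C') zerofam)
  (D1x : forall x v, x \in xs -> D1 (x v) = x (D1 v))
  (D2x : forall x v, x \in xs -> D2 (x v) = x (D2 v))
  (D1C : forall n v, C n v -> C' n (D1 v))
  (D2C : forall n v, C2 n v -> C n (D2 v))
  (D12 : forall n v, C2 n v -> D1 (D2 v) = 0).

(* Cycles and boundaries of the complex C2 -> C -> C' taken modulo the m-th power
   of the ideal. *)
Definition cycfam : family T := fun m n => C n `&` D1 @^-1` bpow bs m (C' n).
Definition boufam : family T := fun m n => sumset (D2 @` C2 n) (bpow bs m (C n)).

(* The cycles modulo Q are finitely generated by Artin-Rees. Q modulo the boundaries
   is Ker / G, and only the quotients G m n / G m.+1 n are finitely generated over the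
   bigraded ring, while for fixed m the whole Ker / G m is finitely generated over the
   operators xs. *)
Let Ker n : set T := C n `&` D1 @^-1` [set 0].
Let Im n : set T := D2 @` C2 n.
Let Q : family T := fun m n => sumset (Ker n) (bpow bs m (C n)).
Let G : family T := fun m n => sumset (Ker n `&` bpow bs m (C n)) (Im n).

Let hKer n : submodset (Ker n).
Proof. exact/submodsetI/submodset_preimage/submodset_set0. Qed.

Let hIm n : submodset (Im n).
Proof. exact: submodset_image. Qed.

Let hpow m n : submodset (bpow bs m (C n)).
Proof. exact: submodset_bpow. Qed.

Let xKer x n v : x \in xs -> Ker n v -> Ker n.+1 (x v).
Proof.
move=> xin [Cv Dv]; split; first exact: xC.
by rewrite /= D1x // [D1 v]Dv (map0_linear (lin_xs xin)).
Qed.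

Let xIm x n v : x \in xs -> Im n v -> Im n.+1 (x v).
Proof. by move=> xin [u Cu <-]; exists (x u); [exact: xC2 | rewrite D2x]. Qed.

Let ImKer n : Im n `<=` Ker n.
Proof. by move=> _ [u Cu <-]; split; [exact: D2C | exact: (D12 Cu)]. Qed.

Let stable_cyc : stable ideal_ops cycfam.
Proof.
have sC := (const_opsP hC xC).2; have sC' := stable_bpow hC' xC'.
split=> [m n|a b o oin m n v [Cv Dv]].
  exact/submodsetI/submodset_preimage/submodset_bpow.
split; first exact: sC.2 oin m n v Cv.
have -> : (D1 @^-1` bpow bs (a + m) (C' (b + n)%N)) (o v) =
    bpow bs (a + m) (C' (b + n)%N) (o (D1 v)).
  congr (bpow _ _ _ _); case/bigraded_opsP: oin => -[_ _].
    by move=> /mapP[c _ ->]; rewrite linearZ.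
  exact: D1x.
exact: sC'.2 oin _ _ _ Dv.
Qed.

Let stable_Q : stable ideal_ops Q.
Proof.
apply: stable_sumfam; first exact: good_ideal_ops.
  exact: (const_opsP hKer xKer).2.
exact: stable_bpow.
Qed.

Let QZ : subfam Q cycfam.
Proof.
move=> m n; apply: sumset_min; first exact: stable_cyc.1.
  by move=> v [Cv Dv]; split=> //=; rewrite [D1 v]Dv; exact: (submodset0 (submodset_bpow _ _ (hC' n))).
move=> v Cv; split; first exact: bpow_sub Cv.
by apply: bpow_linear Cv => u; apply: D1C.
Qed.

Let BQ : subfam boufam Q.
Proof. by move=> m n; apply: sumset_mono; first exact: ImKer. Qed.

(* Artin-Rees: the intersections of D1 (C n) with the powers of the ideal times
   C' n form a finitely generated module over the bigraded Rees algebra. *)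
Let fg_cyc : fg_mod ideal_ops cycfam Q.
Proof.
pose E : family T := fun m n => D1 @` C n `&` bpow bs m (C' n).
have sC' := stable_bpow hC' xC'.
have sE : stable ideal_ops E.
  apply: stableI => //; apply: (const_opsP _ _).2 => [n|x n _ xin [u Cu <-]].
    exact: submodset_image.
  by exists (x u); [exact: xC | rewrite D1x].
have [||H HE EH] := fg_mod_sub hR good_ideal_ops (stable_zerofam good_ideal_ops) sC' sE.
- by move=> m n v [].
- exact: fg_bpow.
(* D1 maps the cycles onto E with kernel Ker, which lies in Q. Hence preimages of generators of E
   generate the cycles modulo Q. *)
have [h hh] : exists h : nat * nat * T -> T, forall e, e \in H ->
    C e.1.2 (h e) /\ D1 (h e) = e.2.
  apply: (seq_choice 0 (P := fun e u => C e.1.2 u /\ D1 u = e.2)).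
  by move=> [[m n] v] /HE[[u Cu <-] _]; exists u.
pose H' := [seq (e.1.1, e.1.2, h e) | e <- H].
have H'Z : contains cycfam H'.
  move=> m n v /mapP[e eH [-> -> ->]]; have [Ch Dh] := hh _ eH; split=> //.
  by rewrite /= Dh; case: e eH {Ch Dh} => -[? ?] ? /HE[].
exists H' => // m n z [Cz Dz].
have [|w gw /subr0_eq wE] := EH m n (D1 z); first by split=> //; exists z.
pose X : family T := fun m n e => exists2 u, gen ideal_ops H' m n u & D1 u = e.
have [u gu uE] : X m n w.
  apply: (gen_min _ _ gw) => [|m' n' v vH]; last first.
    by exists (h (m', n', v)); [apply: gen_in; apply/mapP; exists (m', n', v) | have [] := hh _ vH].
  split=> [m' n'|a b o oin m' n' _ [u gu <-]].
    split; first by exists 0; [exact: gen0 | rewrite raddf0].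
    move=> c _ _ [u gu <-] [u' gu' <-]; exists (c *: u + u'); first exact: genP.
    by rewrite linearP.
  exists (o u); first exact: gen_op.
  case/bigraded_opsP: oin => -[_ _]; last exact: D1x.
  by move=> /mapP[c _ ->]; rewrite linearZ.
have [Cu _] := gen_min stable_cyc H'Z gu.
exists u => //; apply: sumsetl => //; split; first exact: submodsetB.
by rewrite /= raddfB /= uE wE subrr.
Qed.

Let GKer m n : G m n `<=` Ker n.
Proof. by apply: sumset_min. Qed.

Let hG m n : submodset (G m n).
Proof. by apply: submodset_sumset => //; apply: submodsetI. Qed.

Let stable_G : stable ideal_ops G.
Proof.
apply: stable_sumfam; first exact: good_ideal_ops.
  by apply: stableI (stable_bpow hC xC); exact: (const_opsP hKer xKer).2.
exact: (const_opsP hIm xIm).2.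
Qed.

(** Since Im lies in Ker, the modular law identifies the intersection of Ker with Im + J ^ m C as G;
    the rest is the second isomorphism theorem. *)
Let rlen_Q m n l : rlen (boufam m n) (Q m n) l <-> rlen (G m n) (Ker n) l.
Proof.
have hB : submodset (boufam m n) := submodset_sumset (hIm n) (hpow m n).
rewrite -(@rlen_map_onto _ _ _ idfun (G m n) (Ker n) (boufam m n) (Q m n)) //.
- exact: stable_Q.1.
- move=> v Kv; split.
    move=> [u [Ku pu] iu]; exists (v - u) => //; rewrite opprB addrC subrK //.
  move=> [u iu pu]; exists (v - u); last by rewrite opprB addrC subrK.
  by split=> //; apply: (submodsetB (hKer n)) => //; exact: ImKer iu.
- by move=> v Kv; exact: (sumsetl (hpow m n) Kv).
- by move=> v [u Ku pu]; exists u => //; exact: (sumsetr (hIm n) pu).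
Qed.

Theorem homology_length_evpoly : evfinite boufam cycfam ->
  evpoly (fun m n => (lenfam boufam cycfam m n)%:R).
Proof.
move=> [m0 [n0 fin]].
have hB m n : submodset (boufam m n) := submodset_sumset (hIm n) (hpow m n).
have add m n mm nn := rlen_add (hB m n) (stable_Q.1 m n) (stable_cyc.1 m n)
  (@BQ m n) (@QZ m n) (fin m n mm nn).
apply: (@evpoly_eq _ (fun m n => (lenfam G (const_fam Ker) m n)%:R +
    (lenfam Q cycfam m n)%:R) m0 n0) => [m n mm nn|].
  have [f1 f2 lenE12] := add m n mm nn.
  rewrite [in LHS]/lenfam lenE12 natrD; congr (_%:R + _).
  by apply/esym/lenE/rlen_Q/lenP.
apply: evpolyD; last first.
  apply: (hilbert_polynomial hR good_ideal_ops) => //.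
  by exists m0, n0 => m n mm nn; have [] := add m n mm nn.
have finG m n : (m0 <= m)%N -> (n0 <= n)%N -> rfin (G m n) (Ker n).
  by move=> mm nn; have [[l /rlen_Q hl] _ _] := add m n mm nn; exists l.
have GS m n : G m.+1 n `<=` G m n.
  by apply: sumset_mono => // v [Kv /(bpow_succ (hC n))].
have addG m n mm nn := rlen_add (hG m.+1 n) (hG m n) (hKer n)
  (GS m n) (@GKer m n) (finG m.+1 n (leqW mm) nn).
apply: (@evpoly_sum _ (fun m n => (lenfam (fun m => G m.+1) G m n)%:R) m0 n0).
- apply: (hilbert_polynomial hR good_ideal_ops) => //.
  + split=> [m n|a b o oin m n v Gv]; first exact: hG.
    by have := stable_G.2 _ _ _ oin _ _ _ Gv; rewrite addnS.
  (* Modulo Im, which G m.+1 contains, G m is generated by Ker [&] J ^ m C, a submodule of the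
     finitely generated Rees module of C. *)
  + apply: (@fg_mod_mono _ _ _ _ (const_fam Im)).
      by move=> m n; apply: sumsetr; apply: submodsetI.
    have sK : stable ideal_ops (fun m n => Ker n `&` bpow bs m (C n)).
      by apply: stableI (stable_bpow hC xC); exact: (const_opsP hKer xKer).2.
    have [|| H HK KH] := fg_mod_sub hR good_ideal_ops (stable_zerofam good_ideal_ops)
        (stable_bpow hC xC) sK.
    * by move=> m n v [].
    * exact: fg_bpow.
    exists H => [m n v /HK Kv|m n v [u /KH[w gw /subr0_eq ->] iu]].
      exact: sumsetl.
    by exists w.
  + by exists m0, n0 => m n mm nn; have [] := addG m n mm nn.
- move=> m n mm nn; have [_ _] := addG m n mm nn.
  by rewrite /lenfam /const_fam => ->; rewrite natrD addrK.
- exists m0 => m mm.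
  apply: (hilbert_polynomial hR good_const_ops (U := const_fam (G m))
    (W := const_fam Ker)).
  + apply: (const_opsP _ _).1 => [n|x n v xin Gv]; first exact: hG.
    have oin : (0%N, 1%N, x) \in ideal_ops by rewrite mem_cat map_f ?orbT.
    exact: stable_G.2 oin _ _ _ Gv.
  + exact: (const_opsP hKer xKer).1.
  + by move=> k n; apply: GKer.
  + apply: (@fg_mod_mono _ _ _ _ zerofam) => [k n v ->|].
      exact: (submodset0 (hG m n)).
    apply: (fg_mod_sub hR good_const_ops _ (const_opsP hC xC).1) => //.
    * exact: stable_zerofam good_const_ops.
    * exact: (const_opsP hKer xKer).1.
    * by move=> k n v [].
  + by exists 0%N, n0 => k n _ nn; apply: finG.
Qed.

End HomologyLength.

(** * Free modules and tensor products *)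

Section FreeModules.
Variables (R : pzRingType) (X : choiceType).

(** Only basis elements in the support of u are needed, which permits the same induction inside a
    graded piece. *)
Lemma free_min (U : set (free R X)) (u : free R X) : submodset U ->
  (forall x, submod_val u x != 0 -> U (free_basis x)) -> U u.
Proof.
move=> hU Ub; have [A uA] := free_suppP u.
pose B := [seq x <- undup A | submod_val u x != 0].
have uB : uniq B by rewrite filter_uniq ?undup_uniq.
have uE : u = \sum_(x <- B) (submod_val u x : R) *: free_basis x.
  apply: val_inj => /=; apply/funext => y.
  have ev_linear : linear (fun v : free R X => submod_val v y : R^o).
    by move=> a v w; rewrite submod_val_linear !fctE.
  pose ev : {linear free R X -> R^o} :=
    HB.pack (fun v : free R X => submod_val v y : R^o)
      (GRing.isLinear.Build _ _ _ _ _ ev_linear).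
  rewrite -[RHS]/(ev _) raddf_sum /=.
  rewrite (eq_bigr (fun x => (submod_val u x : R^o) * (if y == x then 1 else 0)))
    => [|x _]; last by rewrite fctE.
  have [yB|yB] := boolP (y \in B).
    rewrite (bigD1_seq y) //= eqxx big1 => [|x xy]; first by rewrite addr0 [RHS]mulr1.
    by rewrite eq_sym (negbTE xy) mulr0.
  rewrite big_seq big1 => [|x xB]; last first.
    by case: eqP yB => [->|_ _]; [rewrite xB | rewrite mulr0].
  move: yB; rewrite mem_filter negb_and mem_undup => /orP[|/uA//].
  by rewrite negbK => /eqP.
rewrite uE big_seq_cond; elim/big_ind: _ => [||x].
- exact: submodset0.
- by move=> v w; apply: submodsetD.
- by rewrite andbT mem_filter => /andP[/Ub ? _]; apply: submodsetZ.
Qed.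

Lemma free_ext (V : lmodType R) (f g : {linear free R X -> V}) :
  (forall x, f (free_basis x) = g (free_basis x)) -> f =1 g.
Proof.
move=> fg u; apply: (@free_min [set u | f u = g u]) => [|x _]; last exact: fg.
exact: submodset_eq.
Qed.

End FreeModules.

Section Projectives.
Variable R : pzRingType.

(** Only the values of g have to lie in the image of f. Exactness of a complex can thus be used
    directly, without restricting f to a surjection. *)
Definition projective (Q : lmodType R) := forall (V W : lmodType R)
    (f : {linear V -> W}) (g : {linear Q -> W}),
  (forall q, exists v, f v = g q) -> exists h : {linear Q -> V}, forall q, f (h q) = g q.

Lemma projective_retract (X : choiceType) (Q : lmodType R)
    (s : {linear Q -> free R X}) (r : {linear free R X -> Q}) :
  (forall q, r (s q) = q) -> projective Q.
Proof.
move=> rs V W f g fg.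
have /choice[h hh] : forall x, exists v, f v = g (r (free_basis x)) by move=> x; apply: fg.
exists (free_lift h \o s) => q /=.
rewrite -{2}(rs q).
have := @free_ext R X W (f \o free_lift h) (g \o r).
by move=> /(_ _ (s q)) /= -> // x /=; rewrite free_lift_basis.
Qed.

Lemma projective_free (X : choiceType) : projective (free R X).
Proof. exact: (@projective_retract X _ idfun idfun). Qed.

End Projectives.

Section TensorLemmas.
Variable R : comPzRingType.

Lemma tensor_min (A B : lmodType R) (U : set (tensor A B)) : submodset U ->
  (forall a b, U (tens a b)) -> forall t, U t.
Proof.
move=> hU Ut t; rewrite -(quotmod_reprK t).
apply: (@free_min _ _ (quotmod_pi (span (tensor_rel A B)) @^-1` U)).
  exact: submodset_preimage.
by move=> -[a b] _; apply: Ut.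
Qed.

Lemma tensor_ext (A B W : lmodType R) (f g : {linear tensor A B -> W}) :
  (forall a b, f (tens a b) = g (tens a b)) -> f =1 g.
Proof.
move=> fg; apply: (@tensor_min _ _ [set t | f t = g t]) => //.
exact: submodset_eq.
Qed.

Lemma tens0l (A B : lmodType R) (b : B) : tens (0 : A) b = 0.
Proof. by rewrite -[0 in LHS](scale0r (0 : A)) tensZl scale0r. Qed.

Lemma tens0r (A B : lmodType R) (a : A) : tens a (0 : B) = 0.
Proof. by rewrite -[0 in LHS](scale0r (0 : B)) tensZr scale0r. Qed.

Lemma tensBr (A B : lmodType R) (a : A) (b b' : B) :
  tens a (b - b') = tens a b - tens a b'.
Proof. by rewrite tensDr -scaleN1r tensZr scaleN1r. Qed.

Section Bilinear.
Variables (A B W : lmodType R) (be : A -> B -> W).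
Hypotheses (be_l : forall b, linear (be^~ b)) (be_r : forall a, linear (be a)).

Fact tensor_lift_subproof (z : free R (A * B)%type) :
  z \in span (tensor_rel A B) -> free_lift (fun ab => be ab.1 ab.2) z = 0.
Proof.
pose F : {linear free R (A * B)%type -> W} := free_lift (fun ab => be ab.1 ab.2).
move=> /span_minset h; apply: (h (F @^-1` [set 0])).
  exact/submodset_preimage/submodset_set0.
have D1 a a' b : be (a + a') b = be a b + be a' b.
  by have := be_l b 1 a a'; rewrite !scale1r.
have D2 a b b' : be a (b + b') = be a b + be a b'.
  by have := be_r a 1 b b'; rewrite !scale1r.
have z1 b : be 0 b = 0 by apply: (addIr (be 0 b)); rewrite -D1 !add0r.
have z2 a : be a 0 = 0 by apply: (addIr (be a 0)); rewrite -D2 !add0r.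
have Z1 r a b : be (r *: a) b = r *: be a b.
  by have := be_l b r a 0; rewrite !addr0 => ->; rewrite z1 addr0.
have Z2 r a b : be a (r *: b) = r *: be a b.
  by have := be_r a r b 0; rewrite !addr0 => ->; rewrite z2 addr0.
move=> _ []; move=> *; rewrite /= /F !raddfB /= ?free_liftZ !free_lift_basis /=.
- by rewrite D1 addrAC addrK subrr.
- by rewrite D2 addrAC addrK subrr.
- by rewrite Z1 subrr.
- by rewrite Z2 subrr.
Qed.

Definition tensor_lift : {linear tensor A B -> W} := quotmod_lift tensor_lift_subproof.

Lemma tensor_liftE a b : tensor_lift (tens a b) = be a b.
Proof. exact: etrans (quotmod_liftE _ _) (free_lift_basis _ _). Qed.

End Bilinear.

Section Bimap.
Variables (A A' B B' : lmodType R) (f : {linear A -> A'}) (g : {linear B -> B'}).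

Fact tensor_bimap_l b : linear (fun a => tens (f a) (g b)).
Proof. by move=> r a a'; rewrite linearP tensDl tensZl. Qed.

Fact tensor_bimap_r a : linear (fun b => tens (f a) (g b)).
Proof. by move=> r b b'; rewrite linearP tensDr tensZr. Qed.

Definition tensor_bimap : {linear tensor A B -> tensor A' B'} :=
  tensor_lift tensor_bimap_l tensor_bimap_r.

Lemma tensor_bimapE a b : tensor_bimap (tens a b) = tens (f a) (g b).
Proof. exact: tensor_liftE. Qed.

End Bimap.

Lemma tensor_map_comp (A1 A2 A3 B : lmodType R) (f : {linear A2 -> A3})
    (g : {linear A1 -> A2}) (h : {linear A1 -> A3}) :
  (forall a, f (g a) = h a) ->
  forall t, tensor_map B f (tensor_map B g t) = tensor_map B h t.
Proof.
move=> fgh t; apply: (@tensor_ext _ _ _ (tensor_map B f \o tensor_map B g)).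
move=> a b; rewrite -[LHS]/(tensor_map B f (tensor_map B g (tens a b))).
by rewrite !tensor_mapE fgh.
Qed.

Lemma tensor_map0 (A1 A2 B : lmodType R) (t : tensor A1 B) :
  tensor_map B (\0 : {linear A1 -> A2}) t = 0.
Proof.
apply: (tensor_ext (f := tensor_map B \0) (g := \0)) => a b.
by rewrite tensor_mapE tens0l.
Qed.

(* Right exactness of the tensor product in its second argument. *)
Lemma tensor_quot_ker (Q N : lmodType R) (U : submodClosed N)
    (S : set (tensor Q N)) : submodset S ->
    (forall q u, u \in U -> S (tens q u)) ->
  forall t, tensor_bimap (@idfun Q) (quotmod_pi U) t = 0 -> S t.
Proof.
move=> hS SU.
pose pi : {linear tensor Q N -> quotmod (asub hS)} := quotmod_pi (asub hS).
have piE x y : S (x - y) -> pi x = pi y.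
  by move=> Sxy; apply/quotmod_piP/asboolP.
(* A map back from the tensor product with N / U to the quotient by S. The choice of representatives
   is harmless because S contains every [tens q u] with u in U. *)
pose be (q : Q) (y : quotmod U) := pi (tens q (repr y)).
have be_l y : linear (be^~ y).
  by move=> r a a'; rewrite /be tensDl tensZl linearP.
have be_r q : linear (be q).
  move=> r y y'; rewrite /be -linearP; apply: piE.
  rewrite -tensZr -tensDr -tensBr; apply: SU; apply/quotmod_piP.
  by rewrite quotmod_pi_linear !quotmod_reprK.
move=> t gt0; suff /asboolP : t \in asub hS by [].
rewrite -[t]subr0; apply/quotmod_piP.
rewrite raddf0 -[LHS]/(pi t).
rewrite -(@tensor_ext _ _ _ (tensor_lift be_l be_r \o
  tensor_bimap (@idfun Q) (quotmod_pi U)) pi _ t) => [|a b]; last first.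
  rewrite -[LHS]/(tensor_lift be_l be_r (tensor_bimap idfun (quotmod_pi U) (tens a b))).
  rewrite tensor_bimapE tensor_liftE.
  by apply: piE; rewrite -tensBr; apply: SU; apply/quotmod_piP; rewrite quotmod_reprK.
rewrite -[LHS]/(tensor_lift be_l be_r (tensor_bimap idfun (quotmod_pi U) t)).
by rewrite gt0 raddf0.
Qed.

End TensorLemmas.

(** * Graded free modules over a polynomial ring *)

Section GradedFreeModule.
Variables (R : comPzRingType) (r : nat).

(* (j, al) stands for X ^ al e_j in a free module over R[X_1, ..., X_r]; the degree
   of e_j is [nth 0 ds j]. *)
Definition fmono := (nat * {ffun 'I_r -> nat})%type.
Definition freeX := free R fmono.

Definition mshift (i : 'I_r) (z : fmono) : fmono :=
  (z.1, [ffun j => z.2 j + (j == i)]%N).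

Definition mulX (i : 'I_r) : {linear freeX -> freeX} :=
  free_lift (fun z => free_basis (mshift i z)).

Definition fmono_deg (ds : seq nat) (n : nat) (z : fmono) : bool :=
  (z.1 < size ds)%N && (nth 0%N ds z.1 + \sum_i z.2 i == n)%N.

Definition piece (ds : seq nat) (n : nat) : set freeX :=
  [set u | forall z, submod_val u z != 0 -> fmono_deg ds n z].

Definition mulXs : seq (freeX -> freeX) := [seq (mulX i : freeX -> freeX) | i <- enum 'I_r].

Lemma mulXP x : x \in mulXs -> exists i, x = mulX i.
Proof. by move=> /mapP[i _ ->]; exists i. Qed.

Lemma mulX_in i : (mulX i : freeX -> freeX) \in mulXs.
Proof. by apply: map_f; rewrite mem_enum. Qed.

Lemma mulX_basis i z : mulX i (free_basis z) = free_basis (mshift i z).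
Proof. exact: free_lift_basis. Qed.

Lemma mulX_comm i j u : mulX i (mulX j u) = mulX j (mulX i u).
Proof.
apply: (@free_ext _ _ _ (mulX i \o mulX j) (mulX j \o mulX i)) => z.
rewrite -[LHS]/(mulX i (mulX j (free_basis z))).
rewrite -[RHS]/(mulX j (mulX i (free_basis z))) !mulX_basis; congr free_basis.
congr pair; apply/ffunP => k; rewrite !ffunE addnAC //.
Qed.

Lemma lin_mulXs x : x \in mulXs -> linear x.
Proof. by move=> /mulXP[i ->] a u v; rewrite linearP. Qed.

Lemma comm_mulXs x y : x \in mulXs -> y \in mulXs -> forall v, x (y v) = y (x v).
Proof. by move=> /mulXP[i ->] /mulXP[j ->] v; apply: mulX_comm. Qed.

Lemma submodset_piece ds n : submodset (piece ds n).
Proof.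
split=> [z|a u v Pu Pv z]; first by rewrite /= eqxx.
rewrite submod_val_linear !fctE => nz.
have [u0|] := eqVneq (submod_val u z) 0; last exact: Pu.
apply: Pv; apply: contraNneq nz => v0.
by rewrite u0 v0 scaler0 addr0.
Qed.

Lemma piece_basis ds n z : fmono_deg ds n z -> piece ds n (free_basis z).
Proof. by move=> dz y /=; case: (y =P z) => [->//|_]; rewrite eqxx. Qed.

Lemma piece_min ds n (U : set freeX) : submodset U ->
  (forall z, fmono_deg ds n z -> U (free_basis z)) -> piece ds n `<=` U.
Proof. by move=> hU Ub u Pu; apply: free_min => // z /Pu; apply: Ub. Qed.

Lemma mshift_deg ds n i z : fmono_deg ds n z -> fmono_deg ds n.+1 (mshift i z).
Proof.
rewrite /fmono_deg /= => /andP[-> /eqP <-] /=; apply/eqP.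
under eq_bigr do rewrite ffunE; rewrite big_split /= addnA -addn1; congr addn.
by rewrite -big_mkcond big_pred1_eq.
Qed.

Lemma piece_mulX ds x n u : x \in mulXs -> piece ds n u -> piece ds n.+1 (x u).
Proof.
move=> /mulXP[i ->]; apply: (@piece_min ds n (mulX i @^-1` piece ds n.+1)).
  exact/submodset_preimage/submodset_piece.
by move=> z dz; rewrite /= -/(mulX i _) mulX_basis; apply/piece_basis/mshift_deg.
Qed.

Definition piece_gens ds : seq (nat * nat * freeX) :=
  [seq (0%N, nth 0%N ds j, free_basis (j, [ffun=> 0%N])) | j <- iota 0 (size ds)].

Lemma piece_gen ds m n : piece ds n `<=` gen (const_ops mulXs) (piece_gens ds) m n.
Proof.
elim: m => [|m IH]; last first.
  move=> u /IH gu; rewrite -[n]add0n -add1n.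
  by apply: (gen_op (o := id)) gu; rewrite inE eqxx.
apply: piece_min => [|[j al]]; first exact: submodset_gen.
rewrite /fmono_deg /= => /andP[jlt /eqP <-].
have [d] := ubnP (\sum_i al i)%N; elim: d al => // d IH al le_d.
have [al0|] := boolP [forall i, al i == 0%N].
  rewrite big1 => [|i _]; last exact/eqP/(forallP al0).
  rewrite addn0; apply: gen_in; apply/mapP; exists j; first by rewrite mem_iota.
  by congr (_, free_basis (_, _)); apply/ffunP => i; rewrite ffunE; apply/eqP/(forallP al0).
move=> /forallPn[i]; rewrite -lt0n => ai.
pose be : {ffun 'I_r -> nat} := [ffun k => al k - (k == i)]%N.
have alE : al = (mshift i (j, be)).2.
  apply/ffunP => k; rewrite !ffunE subnK //.
  by case: eqP => [->|].
have sE : (\sum_k al k = 1 + \sum_k be k)%N.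
  rewrite [in LHS]alE; under eq_bigr do rewrite ffunE; rewrite big_split addnC /=.
  by congr addn; rewrite -big_mkcond big_pred1_eq.
rewrite sE addnCA; have -> : (j, al) = mshift i (j, be) by rewrite {1}alE.
rewrite -mulX_basis; apply: (gen_op (a := 0) (b := 1) (m := 0)).
  by rewrite mem_cat map_f ?orbT // mulX_in.
by apply: IH; move: le_d; rewrite sE.
Qed.

Lemma stable_piece ds : stable (const_ops mulXs) (const_fam (piece ds)).
Proof. exact: (const_opsP [::] (@submodset_piece ds) (@piece_mulX ds)).1. Qed.

Lemma piece_gens_in ds : contains (const_fam (piece ds)) (piece_gens ds).
Proof.
move=> m n v /mapP[j]; rewrite mem_iota => /andP[_ jlt] [_ -> ->].
apply: piece_basis; rewrite /fmono_deg jlt /= big1 ?addn0 // => i _.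
by rewrite ffunE.
Qed.

Lemma fg_piece ds : fg_mod (const_ops mulXs) (const_fam (piece ds)) zerofam.
Proof.
exists (piece_gens ds); first exact: piece_gens_in.
by move=> m n v /(@piece_gen ds m n) gv; exists v => //; rewrite subrr.
Qed.

Definition Piece ds n := submod (asub (submodset_piece ds n)).

Definition piece_val ds n : {linear Piece ds n -> freeX} := @submod_val _ _ _.
Arguments piece_val {ds n}.

(** The default 0 of [insubd] kills the basis elements of other degrees. The resulting projection
    makes a piece a retract of a free module, hence projective. *)
Definition piece_proj ds n : {linear freeX -> Piece ds n} :=
  free_lift (fun z => insubd 0 (free_basis z)).

Lemma piece_projK ds n u : piece ds n u -> piece_val (piece_proj ds n u) = u.
Proof.
move: u; apply: piece_min => [|z dz].
  exact: (submodset_eq (piece_val \o piece_proj ds n) idfun).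
rewrite /= /piece_proj /= free_lift_basis insubdK //.
exact/asboolP/piece_basis.
Qed.

Lemma piece_valP ds n (q : Piece ds n) : piece ds n (piece_val q).
Proof. by case: q => u /= /asboolP. Qed.

Lemma piece_valK ds n q : piece_proj ds n (piece_val q) = q.
Proof. by apply: val_inj; apply: piece_projK; apply: piece_valP. Qed.

Lemma projective_Piece ds n : projective (Piece ds n).
Proof. exact: projective_retract (@piece_valK ds n). Qed.

Section Presentation.
Variables (V : lmodType R) (x : 'I_r -> V -> V).
Hypotheses (lin_x : forall i, linear (x i))
  (comm_x : forall i j v, x i (x j v) = x j (x i v)).

Definition opseq := [seq x i | i <- enum 'I_r].

(** The action of X ^ al restricted to the variables in s; the list is a parameter for the sake of
    induction. *)
Definition mono_act (al : {ffun 'I_r -> nat}) (s : seq 'I_r) (v : V) : V :=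
  foldr (fun i => iter (al i) (x i)) v s.

Let iter_comm k i j v : iter k (x i) (x j v) = x j (iter k (x i) v).
Proof. by elim: k => //= k ->; rewrite comm_x. Qed.

Lemma mono_act_shift i (al : {ffun 'I_r -> nat}) s v : uniq s ->
  mono_act [ffun j => al j + (j == i)]%N s v =
  if i \in s then x i (mono_act al s v) else mono_act al s v.
Proof.
elim: s => //= j s IH /andP[js us]; rewrite inE ffunE IH // [i == j]eq_sym.
case: eqP => [<-|_] /=; last by rewrite addn0; case: ifP => // _; rewrite iter_comm.
by rewrite (negbTE js) addn1.
Qed.

(** The basis vector e_j goes to the j-th generator. Every presentation uses the same ambient
    [freeX], and only [ds] records rank and degrees, so all differentials of a resolution have one
    type. *)
Lemma graded_presentation (A : nat -> set V) :
    (forall n, submodset (A n)) ->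
    (forall y n v, y \in opseq -> A n v -> A n.+1 (y v)) ->
    fg_mod (const_ops opseq) (const_fam A) zerofam ->
  exists ds (e : {linear freeX -> V}),
    (forall i u, e (mulX i u) = x i (e u)) /\ (forall n, e @` piece ds n = A n).
Proof.
move=> hA xA [H HA AH].
pose e : {linear freeX -> V} :=
  free_lift (fun z : fmono => mono_act z.2 (enum 'I_r) (nth 0 [seq h.2 | h <- H] z.1)).
pose ds := [seq h.1.2 | h <- H].
have ebasis z : e (free_basis z) =
    mono_act z.2 (enum 'I_r) (nth 0 [seq h.2 | h <- H] z.1) by exact: free_lift_basis.
have ex i u : e (mulX i u) = x i (e u).
  apply: (@free_min _ _ [set u | e (mulX i u) = x i (e u)]) => [|z _].
    rewrite /mkset; split=> [|a v w vE wE].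
      by rewrite !raddf0 (map0_linear (lin_x i)).
    by rewrite !linearP vE wE lin_x.
  by rewrite /mkset mulX_basis !ebasis mono_act_shift ?enum_uniq // mem_enum.
have e0 j : (j < size H)%N -> e (free_basis (j, [ffun=> 0%N])) = (nth (0%N, 0%N, 0) H j).2.
  move=> jH; rewrite ebasis /=.
  have -> v : mono_act [ffun=> 0%N : nat] (enum 'I_r) v = v.
    by elim: (enum _) => //= k s ->; rewrite ffunE.
  by rewrite (nth_map (0%N, 0%N, 0)).
exists ds, e; split=> // n; apply/seteqP; split.
  move=> _ [u Pu <-].
  suff /(_ 0%N n u (piece_gen 0%N Pu)) : subfam (gen (const_ops mulXs) (piece_gens ds))
      (fun m n => e @^-1` const_fam A m n) by [].
  apply: gen_min => [|m k v /mapP[j]]; last first.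
    rewrite mem_iota size_map => /andP[_ jH] [_ -> ->]; rewrite /= e0 //.
    have := mem_nth (0%N, 0%N, 0) jH; rewrite (nth_map (0%N, 0%N, 0)) //.
    by case: (nth _ _ _) => -[m' k'] h /HA.
  apply: (@const_opsP _ _ _ [::] (fun n => e @^-1` A n) _ _).1 => [k|y k v].
    exact: submodset_preimage.
  by move=> /mulXP[i ->] /= Av; rewrite ex; apply: xA => //; rewrite map_f // mem_enum.
move=> v Av; have [w gw /subr0_eq ->] := AH 0%N n v Av.
suff /(_ _ _ _ gw) : subfam (gen (const_ops opseq) H) (const_fam (fun n => e @` piece ds n)) by [].
apply: gen_min => [|m k h hH]; last first.
  have jH : (index (m, k, h) H < size H)%N by rewrite index_mem.
  exists (free_basis (index (m, k, h) H, [ffun=> 0%N])); last by rewrite e0 // nth_index.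
  apply: (piece_gens_in (m := 0)); apply/mapP; exists (index (m, k, h) H).
    by rewrite mem_iota size_map.
  by rewrite (nth_map (0%N, 0%N, 0)) // nth_index.
apply: (@const_opsP _ _ _ [::] (fun n => e @` piece ds n) _ _).1 => [k|y k u].
  exact/submodset_image/submodset_piece.
move=> /mapP[i _ ->] [p Pp <-]; exists (mulX i p); last exact: ex.
by apply: piece_mulX => //; apply: mulX_in.
Qed.

End Presentation.

End GradedFreeModule.

Arguments piece_proj {R r} ds n.
Arguments piece_val {R r ds n}.

(** * Independence of Tor from the resolution *)

Section Complexes.
Variable R : comPzRingType.

(* Augmented complexes: the module in position 0 is the one being resolved. *)
Definition exact_complex (X : nat -> lmodType R) (d : forall k, {linear X k.+1 -> X k}) :=
  (forall x, exists y, d 0%N y = x) /\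
  forall k y, d k y = 0 <-> exists z, d k.+1 z = y.

(** A total choice, zero if no lift exists. Chain maps and homotopies can then be defined by plain
    recursion, and their equations proved afterwards. *)
Definition lift_of (Q V W : lmodType R) (f : {linear V -> W}) (g : {linear Q -> W}) :
    {linear Q -> V} :=
  if pselect (exists h : {linear Q -> V}, forall q, f (h q) = g q) is left p
  then projT1 (cid p) else \0.

Lemma lift_ofP (Q V W : lmodType R) (f : {linear V -> W}) (g : {linear Q -> W}) :
  projective Q -> (forall q, exists v, f v = g q) ->
  forall q, f (lift_of f g q) = g q.
Proof.
move=> pQ fg q; rewrite /lift_of; case: pselect => [p|[]]; last exact: pQ.
by case: (cid p) => h /=.
Qed.

Section Lifting.
Variables (X Y : nat -> lmodType R).
Variables (dX : forall k, {linear X k.+1 -> X k}) (dY : forall k, {linear Y k.+1 -> Y k}).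
Hypotheses (pX : forall k, projective (X k.+1))
  (dXX : forall k x, dX k (dX k.+1 x) = 0) (eY : exact_complex dY).

Fixpoint chain_lift (f0 : {linear X 0%N -> Y 0%N}) k : {linear X k -> Y k} :=
  match k with
  | 0 => f0
  | k'.+1 => lift_of (dY k') (chain_lift f0 k' \o dX k')
  end.

Lemma chain_liftP f0 k x :
  dY k (chain_lift f0 k.+1 x) = chain_lift f0 k (dX k x).
Proof.
elim: k x => [|k IH] x; apply: lift_ofP => // {}x; first exact: eY.1.
by apply/eY.2; rewrite /= -/(chain_lift f0 k.+1 _) IH dXX raddf0.
Qed.

Variable phi : forall k, {linear X k -> Y k}.
Hypotheses (phi0 : forall x, phi 0 x = 0)
  (phiP : forall k x, dY k (phi k.+1 x) = phi k (dX k x)).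

Fixpoint homotopy k : {linear X k -> Y k.+1} :=
  match k with
  | 0 => \0
  | k'.+1 => lift_of (dY k'.+1) (phi k'.+1 \- (homotopy k' \o dX k'))
  end.

Lemma homotopyP k x :
  phi k.+1 x = dY k.+1 (homotopy k.+1 x) + homotopy k (dX k x).
Proof.
suff H : dY k.+1 (homotopy k.+1 x) = phi k.+1 x - homotopy k (dX k x).
  by rewrite H subrK.
elim: k x => [|k IH] x; apply: lift_ofP => // {}x; apply/eY.2.
  by rewrite /= raddfB /= raddf0 subr0 phiP phi0.
rewrite -[LHS]/(dY k.+1 (phi k.+2 x - homotopy k.+1 (dX k.+1 x))).
by rewrite linearB phiP IH dXX raddf0 subr0 subrr.
Qed.

End Lifting.

Variable B : lmodType R.

Section Homology.
Variables (X : nat -> lmodType R) (d : forall k, {linear X k.+1 -> X k}).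

(** Homological degree i sits in position i + 1 of the augmented complex; the augmentation itself
    imposes no condition. *)
Definition cycset i : set (tensor (X i.+1) B) :=
  if i is k.+1 then tensor_map B (d k.+1) @^-1` [set 0] else setT.

Definition bouset i : set (tensor (X i.+1) B) := range (tensor_map B (d i.+1)).

Arguments cycset : clear implicits.
Arguments bouset : clear implicits.

Lemma submodset_cycset i : submodset (cycset i).
Proof. by case: i => // k; exact/submodset_preimage/submodset_set0. Qed.

Lemma submodset_bouset i : submodset (bouset i).
Proof. exact: submodset_image. Qed.

Lemma bou_cyc i : (forall k x, d k (d k.+1 x) = 0) -> bouset i `<=` cycset i.
Proof.
case: i => // k dd _ [t _ <-]; rewrite /cycset /preimage /mkset.
rewrite (tensor_map_comp (h := \0) (dd k.+1)).
exact: tensor_map0.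
Qed.

End Homology.

Arguments cycset {X} d i _ : rename.
Arguments bouset {X} d i _ : rename.

Lemma chain_map_tensor (X Y : nat -> lmodType R)
    (dX : forall k, {linear X k.+1 -> X k}) (dY : forall k, {linear Y k.+1 -> Y k})
    (phi : forall k, {linear X k -> Y k}) :
  (forall k x, dY k (phi k.+1 x) = phi k (dX k x)) ->
  forall k t, tensor_map B (dY k) (tensor_map B (phi k.+1) t) =
    tensor_map B (phi k) (tensor_map B (dX k) t).
Proof.
move=> phiP k t.
rewrite (tensor_map_comp (h := phi k \o dX k) (phiP k)).
by rewrite (tensor_map_comp (g := dX k) (h := phi k \o dX k)).
Qed.

Lemma chain_map_cycset (X Y : nat -> lmodType R)
    (dX : forall k, {linear X k.+1 -> X k}) (dY : forall k, {linear Y k.+1 -> Y k})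
    (phi : forall k, {linear X k -> Y k}) i t :
  (forall k x, dY k (phi k.+1 x) = phi k (dX k x)) ->
  cycset dX i t -> cycset dY i (tensor_map B (phi i.+1) t).
Proof.
move=> phiP; case: i t => // k t dt.
suff : tensor_map B (dY k.+1) (tensor_map B (phi k.+2) t) = 0 by [].
by rewrite (chain_map_tensor phiP) [tensor_map B (dX k.+1) t]dt raddf0.
Qed.

Lemma chain_map_bouset (X Y : nat -> lmodType R)
    (dX : forall k, {linear X k.+1 -> X k}) (dY : forall k, {linear Y k.+1 -> Y k})
    (phi : forall k, {linear X k -> Y k}) i t :
  (forall k x, dY k (phi k.+1 x) = phi k (dX k x)) ->
  bouset dX i t -> bouset dY i (tensor_map B (phi i.+1) t).
Proof.
move=> phiP [u _ <-]; exists (tensor_map B (phi i.+2) u) => //.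
exact: chain_map_tensor.
Qed.

Lemma homotopic_id (X : nat -> lmodType R) (d : forall k, {linear X k.+1 -> X k})
    (chi : forall k, {linear X k -> X k}) i z :
    (forall k, projective (X k.+1)) -> exact_complex d ->
    (forall x, chi 0%N x = x) -> (forall k x, d k (chi k.+1 x) = chi k (d k x)) ->
  cycset d i z -> bouset d i (z - tensor_map B (chi i.+1) z).
Proof.
move=> pX eX chi0 chiP dz.
have dd k x : d k (d k.+1 x) = 0 by apply/eX.2; exists x.
pose phi k : {linear X k -> X k} := idfun \- chi k.
have phi0 x : phi 0%N x = 0 by rewrite /phi /= chi0 subrr.
have phiP k x : d k (phi k.+1 x) = phi k (d k x).
  by rewrite /phi /= linearB chiP.
pose s := homotopy d d phi; have sP := homotopyP pX dd eX phi0 phiP.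
suff E t : t - tensor_map B (chi i.+1) t = tensor_map B (d i.+1) (tensor_map B (s i.+1) t) +
    tensor_map B (s i) (tensor_map B (d i) t).
  rewrite E; have -> : tensor_map B (s i) (tensor_map B (d i) z) = 0.
    (* In degree 0 there is no cycle condition; the term vanishes because the homotopy starts with
       the zero map. *)
    clear E; case: i z dz => [|k] z dz.
      exact: tensor_map0.
    by rewrite [tensor_map B (d k.+1) z]dz raddf0.
  by rewrite addr0; exists (tensor_map B (s i.+1) z).
refine (@tensor_ext _ _ _ _ (idfun \- tensor_map B (chi i.+1))
  ((tensor_map B (d i.+1) \o tensor_map B (s i.+1)) \+
   (tensor_map B (s i) \o tensor_map B (d i))) _ t) => a b.
rewrite -[LHS]/(tens a b - tensor_map B (chi i.+1) (tens a b)).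
rewrite -[RHS]/(tensor_map B (d i.+1) (tensor_map B (s i.+1) (tens a b)) +
  tensor_map B (s i) (tensor_map B (d i) (tens a b))).
rewrite !tensor_mapE -tensDl -sP -scaleN1r -tensZl scaleN1r -tensDl //.
Qed.

(** Both composites of the lifted chain maps are homotopic to the identity. One homotopy makes [phi]
    reflect boundaries, the other makes it surjective modulo boundaries. *)
Theorem homology_compare (X Y : nat -> lmodType R)
    (dX : forall k, {linear X k.+1 -> X k}) (dY : forall k, {linear Y k.+1 -> Y k})
    (f : {linear X 0%N -> Y 0%N}) (g : {linear Y 0%N -> X 0%N}) i l :
    (forall k, projective (X k.+1)) -> (forall k, projective (Y k.+1)) ->
    exact_complex dX -> exact_complex dY -> cancel f g -> cancel g f ->
  rlen (bouset dX i) (cycset dX i) l <-> rlen (bouset dY i) (cycset dY i) l.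
Proof.
move=> pX pY eX eY fK gK.
have ddX k x : dX k (dX k.+1 x) = 0 by apply/eX.2; exists x.
have ddY k x : dY k (dY k.+1 x) = 0 by apply/eY.2; exists x.
pose phi := chain_lift dX dY f; have phiP := chain_liftP pX ddX eY f.
pose psi := chain_lift dY dX g; have psiP := chain_liftP pY ddY eX g.
pose ab k : {linear X k -> X k} := psi k \o phi k.
pose ba k : {linear Y k -> Y k} := phi k \o psi k.
have abP k x : dX k (ab k.+1 x) = ab k (dX k x) by rewrite /ab /= psiP phiP.
have baP k x : dY k (ba k.+1 x) = ba k (dY k x) by rewrite /ba /= phiP psiP.
have hab z : cycset dX i z -> bouset dX i
    (z - tensor_map B (psi i.+1) (tensor_map B (phi i.+1) z)).
  by rewrite (tensor_map_comp (h := ab i.+1)) //; apply: homotopic_id.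
have hba z : cycset dY i z -> bouset dY i
    (z - tensor_map B (phi i.+1) (tensor_map B (psi i.+1) z)).
  by rewrite (tensor_map_comp (h := ba i.+1)) //; apply: homotopic_id.
apply: (rlen_map_onto (f := tensor_map B (phi i.+1))).
- exact: submodset_cycset.
- exact: submodset_bouset.
- exact: submodset_cycset.
- move=> z cz; split; first exact: chain_map_bouset.
  move=> bz; rewrite -[z](subrK (tensor_map B (psi i.+1) (tensor_map B (phi i.+1) z))).
  apply: submodsetD; [exact: submodset_bouset | exact: hab | exact: chain_map_bouset].
- exact: bou_cyc.
- exact: bou_cyc.
- by move=> z; apply: chain_map_cycset.
- move=> z cz; exists (tensor_map B (psi i.+1) z); last exact: hba.
  exact: chain_map_cycset.
Qed.

Section StandardResolution.
Variable A : lmodType R.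

Definition std_complex k : lmodType R := if k is k'.+1 then resolution A k' else A.

Definition std_diff k : {linear std_complex k.+1 -> std_complex k} :=
  match k with 0 => augmentation A | k'.+1 => differential A k' end.

Lemma std_exact : exact_complex std_diff.
Proof.
split; first exact: augmentation_surj.
case=> [|k] y; last by split=> [/differential_exact|?]; last exact/differential_exact.
split=> [ay|[z <-]]; last first.
  by rewrite /=; case: (augmentation _ z) => u /= /eqP.
have ky : y \in kerm (augmentation A) by apply/eqP.
have [v vE] := augmentation_surj (Submod ky : syzygy A 1).
by exists v; rewrite /= vE.
Qed.

Lemma std_projective k : projective (std_complex k.+1).
Proof. exact: projective_free. Qed.

Lemma Tor_lengthE i l :
  has_length (Tor A B i) l <-> rlen (bouset std_diff i) (cycset std_diff i) l.
Proof.
have cE : [set x | x \in Tor_cycles A B i] = cycset std_diff i.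
  case: i => [|k]; apply/seteqP; split=> x; [by [] | by [] | |].
    by rewrite /mkset unfold_in => /eqP.
  by move=> dx; rewrite /mkset unfold_in; apply/eqP.
have bE : [set x | x \in Tor_boundaries A B i] = bouset std_diff i.
  apply/seteqP; split=> x /=; first by move=> /asboolP[y yx]; exists y.
  by move=> [y _ yx]; apply/asboolP; exists y.
rewrite -cE -bE; apply: rlen_quotmod => x xB.
suff : [set x | x \in Tor_cycles A B i] x by [].
rewrite cE; apply: bou_cyc; last by rewrite -bE.
by move=> k y; apply/std_exact.2; exists y.
Qed.

End StandardResolution.
End Complexes.

Arguments cycset {R} B {X} d i _.
Arguments bouset {R} B {X} d i _.

(** * Graded resolutions of Rees modules *)

Section CanonicalMaps.
Variable R : comPzRingType.

Fact scale_by_linear (V : lmodType R) (x : V) :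
  linear (fun a : R^o => (a : R) *: x).
Proof. by move=> a u v; rewrite scalerDl scalerA. Qed.

Definition scale_by (V : lmodType R) (x : V) : {linear R^o -> V} :=
  HB.pack (fun a : R^o => (a : R) *: x)
    (GRing.isLinear.Build R R^o V *:%R _ (scale_by_linear x)).

Fact tens_linear (A B : lmodType R) (a : A) : linear (tens a : B -> tensor A B).
Proof. by move=> r b b'; rewrite tensDr tensZr. Qed.

Definition tens_by (A B : lmodType R) (a : A) : {linear B -> tensor A B} :=
  HB.pack (tens a : B -> tensor A B)
    (GRing.isLinear.Build R B (tensor A B) *:%R _ (@tens_linear A B a)).

Fact tens_linear_l (A B : lmodType R) (b : B) : linear (fun a : A => tens a b).
Proof. by move=> r a a'; rewrite tensDl tensZl. Qed.

Definition tens_on (A B : lmodType R) (b : B) : {linear A -> tensor A B} :=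
  HB.pack (fun a : A => tens a b)
    (GRing.isLinear.Build R A (tensor A B) *:%R _ (@tens_linear_l A B b)).

Section Corestriction.
Variables (V W : lmodType R) (U : submodClosed W) (f : {linear V -> W}).
Hypothesis fU : forall v, f v \in U.

Definition corestr v : submod U := Submod (fU v).

Fact corestr_linear : linear corestr.
Proof. by move=> a u v; apply: val_inj; rewrite /= linearP. Qed.

HB.instance Definition _ := GRing.isLinear.Build R V (submod U) *:%R corestr corestr_linear.
End Corestriction.
End CanonicalMaps.

Section IdealPowersOfModules.
Variables (R : comPzRingType) (I : submodClosed R^o) (s : seq R^o).
Hypothesis sI : forall x, (x \in I) = (x \in span [set y | y \in s]).

(** Reconciles the power of the ideal applied once with n successive products by the generators
    s. *)
Lemma ideal_exp_mod_bpow (V : lmodType R) n (x : V) :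
  x \in ideal_exp_mod I n V <-> bpow s n setT x.
Proof.
split.
  move: x; apply: span_minset; first exact: submodset_bpow.
  move=> _ [a [x [aI _ ->]]]; elim: n a aI x => [|n IH] // a aI x.
  move: a aI; apply: (@span_minset _ _ _ (scale_by x @^-1` bpow s n.+1 setT)).
    exact/submodset_preimage/submodset_bpow.
  move=> _ [c [d [cI /IH dI ->]]].
  rewrite /= -[_ *: d]/(c * d) -scalerA; move: c cI.
  suff H c : c \in I -> (scale_by (d *: x) @^-1` bpow s n.+1 setT) c by exact: H.
  rewrite sI; apply: span_minset => [|b bs]; last exact: bmul_in bs (dI x).
  exact/submodset_preimage/submodset_bpow.
elim: n x => [|n IH] x; first by rewrite -[x]scale1r => _; apply: sub_span; exists 1, x.
move=> bx; apply: (bx [set y | y \in ideal_exp_mod I n.+1 V]) => [|b u bs /IH].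
  exact: submodset_closed.
move: u; apply: (@span_minset _ _ _ ( *:%R b @^-1` [set y | y \in ideal_exp_mod I n.+1 V])).
  exact/submodset_preimage/submodset_closed.
move=> _ [a [y [aI _ ->]]] /=; rewrite scalerA; apply: sub_span.
exists (b * a), y; split=> //; apply: sub_span; exists b, a; split=> //.
by rewrite sI; apply: sub_span.
Qed.

End IdealPowersOfModules.

Section GradedResolution.
Variables (R : comPzRingType) (hR : noetherian_ring R) (r : nat).
Variables (V : lmodType R) (x : 'I_r -> V -> V).
Hypotheses (lin_x : forall i, linear (x i))
  (comm_x : forall i j v, x i (x j v) = x j (x i v)).

Let E := freeX R r.

Definition presentable (W : lmodType R) (y : 'I_r -> W -> W) (K : nat -> set W) :=
  [/\ forall n, submodset (K n),
      forall z n v, z \in opseq y -> K n v -> K n.+1 (z v) &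
      fg_mod (const_ops (opseq y)) (const_fam K) zerofam].

Definition mulXf (i : 'I_r) : E -> E := mulX R i.

Lemma presentable_ker (W : lmodType R) (y : 'I_r -> W -> W) ds (e : {linear E -> W}) :
    (forall i, linear (y i)) -> (forall i u, e (mulX R i u) = y i (e u)) ->
  presentable mulXf (fun n => piece ds n `&` e @^-1` [set 0]).
Proof.
move=> lin_y ey.
have hK n : submodset (piece ds n `&` e @^-1` [set 0] : set E).
  exact/submodsetI/submodset_preimage/submodset_set0/submodset_piece.
have xK z n (u : E) : z \in opseq mulXf -> (piece ds n `&` e @^-1` [set 0]) u ->
    (piece ds n.+1 `&` e @^-1` [set 0]) (z u).
  move=> zin [Pu eu]; split; first exact: piece_mulX zin Pu.
  have [i ->] := mulXP zin.
  suff : e (mulX R i u) = 0 by [].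
  by rewrite ey [e u]eu (map0_linear (lin_y i)).
split=> //.
have gE : good_ops (const_ops (mulXs R r)).
  exact: good_const_ops (@lin_mulXs R r) (@comm_mulXs R r).
apply: (fg_mod_sub hR gE (stable_zerofam gE) (@stable_piece R r ds)).
- exact: (const_opsP [::] hK xK).1.
- by move=> m n u [].
- exact: fg_piece.
Qed.

Lemma graded_resolution (A : nat -> set V) : presentable x A ->
  exists (ds : nat -> seq nat) (e0 : {linear E -> V}) (e : nat -> {linear E -> E}),
  [/\ forall n, e0 @` piece (ds 0%N) n = A n,
      forall k i u, e k (mulX R i u) = mulX R i (e k u),
      forall n, e 0%N @` piece (ds 1%N) n = piece (ds 0%N) n `&` e0 @^-1` [set 0] &
      forall k n, e k.+1 @` piece (ds k.+2) n = piece (ds k.+1) n `&` e k @^-1` [set 0]].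
Proof.
move=> [hA xA fA].
have [ds0 [e0 [e0x e0A]]] := graded_presentation lin_x comm_x hA xA fA.
(* The resolution is obtained by iterating on kernels; the sigma type hands the finite generation of
   one kernel to the next stage. *)
pose state := {K : nat -> set E | presentable mulXf K}.
have /choice[F hF] : forall K : state, exists p : seq nat * {linear E -> E},
    (forall i u, p.2 (mulX R i u) = mulX R i (p.2 u)) /\
    (forall n, p.2 @` piece p.1 n = sval K n).
  move=> [K [hK xK fK]].
  have [||ds [e he]] := @graded_presentation R r E mulXf _ _ K hK xK fK.
  - by move=> i a u v; rewrite /mulXf linearP.
  - exact: mulX_comm.
  by exists (ds, e).
have lin_mulX i : linear (mulXf i) by move=> a u v; rewrite /mulXf linearP.
pose next (K : state) : state := exist _ _ (presentable_ker (F K).1 lin_mulX (hF K).1).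
pose K0 : state := exist _ _ (presentable_ker ds0 lin_x e0x).
pose K k := iter k next K0.
exists (fun k => if k is k'.+1 then (F (K k')).1 else ds0), e0, (fun k => (F (K k)).2).
split=> //.
- by move=> k; apply: (hF (K k)).1.
- exact: (hF K0).2.
- by move=> k n; rewrite (hF (K k.+1)).2.
Qed.

End GradedResolution.

(** * The graded complex tensored with N, modulo J ^ m *)

Section TensorPieces.
Variables (R : comPzRingType) (r : nat) (N : lmodType R).
Let E := freeX R r.

Definition mulXN (i : 'I_r) : {linear tensor E N -> tensor E N} :=
  tensor_map N (mulX R i).

Definition mulXNs : seq (tensor E N -> tensor E N) :=
  [seq (mulXN i : _ -> _) | i <- enum 'I_r].

Lemma mulXNP y : y \in mulXNs -> exists i, y = mulXN i.
Proof. by move=> /mapP[i _ ->]; exists i. Qed.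

Lemma mulXN_in i : (mulXN i : _ -> _) \in mulXNs.
Proof. by apply: map_f; rewrite mem_enum. Qed.

Lemma lin_mulXNs y : y \in mulXNs -> linear y.
Proof. by move=> /mulXNP[i ->] a u v; rewrite linearP. Qed.

Lemma comm_mulXNs y z : y \in mulXNs -> z \in mulXNs -> forall v, y (z v) = z (y v).
Proof.
move=> /mulXNP[i ->] /mulXNP[j ->] v.
rewrite /mulXN (tensor_map_comp (h := mulX R j \o mulX R i)) => [|u].
  by rewrite (tensor_map_comp (h := mulX R j \o mulX R i)).
exact: mulX_comm.
Qed.

(** The piece tensored with N, viewed inside [tensor E N]. Nothing is lost, because [piece_proj]
    splits the inclusion of the piece. *)
Definition tpiece ds n : set (tensor E N) := range (tensor_map N (@piece_val R r ds n)).

Lemma submodset_tpiece ds n : submodset (tpiece ds n).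
Proof. exact: submodset_image. Qed.

Lemma tpiece_tens ds n u y : piece ds n u -> tpiece ds n (tens u y).
Proof.
by move=> Pu; exists (tens (piece_proj ds n u) y); rewrite // tensor_mapE piece_projK.
Qed.

Lemma tpiece_min ds n (U : set (tensor E N)) : submodset U ->
  (forall u y, piece ds n u -> U (tens u y)) -> tpiece ds n `<=` U.
Proof.
move=> hU Ut _ [t _ <-].
apply: (@tensor_min _ _ _ (tensor_map N (@piece_val R r ds n) @^-1` U)).
  exact: submodset_preimage.
move=> q y; suff : U (tensor_map N piece_val (tens q y)) by [].
by rewrite tensor_mapE; apply: Ut; apply: piece_valP.
Qed.

Lemma tpiece_mulXN ds y n t : y \in mulXNs -> tpiece ds n t -> tpiece ds n.+1 (y t).
Proof.
move=> /mulXNP[i ->]; apply: (@tpiece_min ds n (mulXN i @^-1` tpiece ds n.+1)).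
  exact/submodset_preimage/submodset_tpiece.
move=> u z Pu; suff : tpiece ds n.+1 (mulXN i (tens u z)) by [].
rewrite /mulXN tensor_mapE; apply: tpiece_tens.
exact: piece_mulX (mulX_in R i) Pu.
Qed.

Lemma fg_tpiece ds : fg_module N ->
  fg_mod (const_ops mulXNs) (const_fam (tpiece ds)) zerofam.
Proof.
move=> [s sN].
pose H : seq (nat * nat * tensor E N) :=
  [seq (h.1, tens h.2 y) | h <- piece_gens R r ds, y <- s].
have HC : contains (const_fam (tpiece ds)) H.
  move=> m n t /allpairsP[[[[m' n'] u] y] /= [hin ys [-> -> ->]]].
  exact/tpiece_tens/(piece_gens_in hin).
exists H => // m n t Ct; exists t; last by rewrite /zerofam /mkset subrr.
move: t Ct; apply: tpiece_min => [|u y Pu]; first exact: submodset_gen.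
have : y \in @fullm R N by [].
suff U_span z : z \in span [set y | y \in s] ->
    (tens_by N u @^-1` gen (const_ops mulXNs) H m n) z by rewrite sN => /U_span.
move: z; apply: span_minset.
  exact/submodset_preimage/submodset_gen.
move=> {}y ys; suff gH : subfam (gen (const_ops (mulXs R r)) (piece_gens R r ds))
    (fun m n => tens_on E y @^-1` gen (const_ops mulXNs) H m n).
  exact: gH (piece_gen m Pu).
apply: gen_min => [|m' n' h hin]; last first.
  by apply: gen_in; apply/allpairsP; exists (m', n', h, y).
split=> [m' n'|a b o]; first exact/submodset_preimage/submodset_gen.
rewrite mem_cat => /orP[/mapP[z]|/mapP[z /mulXP[i ->] [-> -> ->]]].
  rewrite inE => /eqP -> [-> -> ->] m' n' v gv.
  by apply: (gen_op (o := id)) gv; rewrite inE eqxx.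
move=> m' n' v gv.
suff : gen (const_ops mulXNs) H (0 + m') (1 + n') (mulXN i (tens v y)).
  by rewrite /mulXN tensor_mapE.
by apply: gen_op gv; rewrite mem_cat map_f ?orbT // mulXN_in.
Qed.

Section Projection.
Variables (J : submodClosed R^o) (bs : seq R^o).
Hypothesis sJ : forall x, (x \in J) = (x \in span [set y | y \in bs]).
Variables (ds : seq nat) (m n : nat).

Let B : lmodType R := quotmod (ideal_exp_mod J m N).

(* [tproj] maps [tpiece ds n] onto the tensor product of the graded piece with
   N / J ^ m N, and its kernel there is J ^ m times [tpiece ds n]. *)
Definition tproj : {linear tensor E N -> tensor (Piece R r ds n) B} :=
  tensor_bimap (piece_proj ds n) (quotmod_pi (ideal_exp_mod J m N)).

Lemma tproj_onto w : exists2 c, tpiece ds n c & tproj c = w.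
Proof.
suff [c Cc cw] : (tproj @` tpiece ds n) w by exists c.
apply: tensor_min => [|q y]; first exact/submodset_image/submodset_tpiece.
exists (tens (piece_val q) (repr y)); first exact/tpiece_tens/piece_valP.
by rewrite /tproj tensor_bimapE piece_valK; congr tens; exact: quotmod_reprK.
Qed.

Lemma bpow_killed (Q : lmodType R) (t : tensor Q B) : bpow bs m setT t -> t = 0.
Proof.
move=> /(ideal_exp_mod_bpow sJ).
apply: (@span_minset _ _ _ [set 0]); first exact: submodset_set0.
move=> _ [a [{}t [aJ _ ->]]].
suff a0 u : [set u : tensor Q B | (a : R) *: u = 0] u by exact: a0.
move: u; apply: tensor_min => [|q y].
  split=> [|c u v au av]; rewrite /mkset ?scaler0 //.
  by rewrite scalerDr scalerA mulrC -scalerA au av scaler0 addr0.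
suff ay0 : (a : R) *: y = 0 by rewrite /mkset -tensZr ay0 tens0r.
rewrite -(raddf0 (quotmod_pi (ideal_exp_mod J m N))) -[in LHS](quotmod_reprK y).
rewrite -[LHS]/(quotmod_scale _ _) -quotmod_pi_scale.
by apply/quotmod_piP; rewrite subr0; apply: sub_span; exists a, (repr y).
Qed.

(** On the piece, [tproj] is induced by the projection of N onto N / J ^ m N, so right exactness
    bounds its kernel. Conversely J ^ m annihilates the target. *)
Lemma tproj_ker c : tpiece ds n c -> tproj c = 0 <-> bpow bs m (tpiece ds n) c.
Proof.
move=> Cc; split; last first.
  by move=> bc; apply: bpow_killed; apply: bpow_linear bc.
case: Cc => t _ <-.
have -> : tproj (tensor_map N piece_val t) =
    tensor_bimap (@idfun (Piece R r ds n)) (quotmod_pi (ideal_exp_mod J m N)) t.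
  apply: (@tensor_ext _ _ _ _ (tproj \o tensor_map N piece_val)) => q y.
  rewrite -[LHS]/(tproj (tensor_map N piece_val (tens q y))).
  by rewrite tensor_mapE /tproj !tensor_bimapE piece_valK.
move: t; apply: (@tensor_quot_ker _ _ _ _
  (tensor_map N piece_val @^-1` bpow bs m (tpiece ds n))).
  exact/submodset_preimage/submodset_bpow/submodset_tpiece.
move=> q u /(ideal_exp_mod_bpow sJ) bu.
suff : bpow bs m (tpiece ds n) (tensor_map N piece_val (tens q u)) by [].
rewrite tensor_mapE; apply: (bpow_linear (f := tens_by N (piece_val q))) bu => y _.
exact/tpiece_tens/piece_valP.
Qed.

End Projection.

End TensorPieces.

Arguments tpiece {R r} N ds n _.
Arguments tproj {R r} N J ds m n.

Section TorOfPieces.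
Variables (R : comPzRingType) (r : nat) (M N : lmodType R).
Let E := freeX R r.
Variables (ds : nat -> seq nat) (e0 : {linear E -> M}) (e : nat -> {linear E -> E}).
Variables (J : submodClosed R^o) (bs : seq R^o).
Hypothesis sJ : forall x, (x \in J) = (x \in span [set y | y \in bs]).

Definition tdiff k : {linear tensor E N -> tensor E N} := tensor_map N (e k).

(* In homological degree 0 there is no outgoing differential. *)
Definition prev_diff i : {linear tensor E N -> tensor E N} :=
  if i is k.+1 then tdiff k else \0.

Definition prev_piece i : nat -> set (tensor E N) :=
  if i is k.+1 then tpiece N (ds k) else tpiece N (ds 0%N).

Hypothesis eP : forall k n u, piece (ds k.+1) n u -> piece (ds k) n (e k u).
Hypothesis ee0 : forall k n u, piece (ds k.+2) n u -> e k (e k.+1 u) = 0.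

Lemma tdiff_piece k n t : tpiece N (ds k.+1) n t -> tpiece N (ds k) n (tdiff k t).
Proof.
move: t; apply: (@tpiece_min _ _ _ _ _ (tdiff k @^-1` tpiece N (ds k) n)).
  exact/submodset_preimage/submodset_tpiece.
move=> u y Pu; suff : tpiece N (ds k) n (tdiff k (tens u y)) by [].
by rewrite /tdiff tensor_mapE; apply/tpiece_tens/eP.
Qed.

Lemma prev_diff_piece i n t : tpiece N (ds i) n t -> prev_piece i n (prev_diff i t).
Proof.
case: i t => [|k] t; last exact: tdiff_piece.
by move=> _; apply: submodset0; apply: submodset_tpiece.
Qed.

Lemma prev_diff_diff i n t : tpiece N (ds i.+1) n t -> prev_diff i (tdiff i t) = 0.
Proof.
case: i t => // k t Ct.
suff : [set t | (tdiff k \o tdiff k.+1) t = (\0 : {linear _ -> _}) t] t by [].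
move: t Ct; apply: tpiece_min; first exact: submodset_eq.
move=> u y Pu; suff : tdiff k (tdiff k.+1 (tens u y)) = 0 by [].
by rewrite /tdiff !tensor_mapE (ee0 Pu) tens0l.
Qed.

Variables (m n : nat) (A : submodClosed M).
Hypotheses (e0A : e0 @` piece (ds 0%N) n = [set v | v \in A])
  (e0_ker : e 0%N @` piece (ds 1%N) n = piece (ds 0%N) n `&` e0 @^-1` [set 0])
  (e_ker : forall k, e k.+1 @` piece (ds k.+2) n =
     piece (ds k.+1) n `&` e k @^-1` [set 0]).

Let B : lmodType R := quotmod (ideal_exp_mod J m N).

Definition piece_complex k : lmodType R :=
  if k is k'.+1 then Piece R r (ds k') n else submod A.

Let augP q : (e0 \o @piece_val R r (ds 0%N) n) q \in A.
Proof.
suff : [set v | v \in A] (e0 (piece_val q)) by [].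
by rewrite -e0A; exists (piece_val q) => //; apply: piece_valP.
Qed.

Definition piece_diff k : {linear piece_complex k.+1 -> piece_complex k} :=
  match k with
  | 0 => corestr augP
  | k'.+1 => piece_proj (ds k') n \o e k' \o piece_val
  end.

Let piece_diffE k q : piece_val (piece_diff k.+1 q) = e k (piece_val q).
Proof. by apply: piece_projK; apply: eP; apply: piece_valP. Qed.

Let piece_inj ds' : injective (@piece_val R r ds' n).
Proof. exact: can_inj (@piece_valK R r ds' n). Qed.

Lemma piece_exact : exact_complex piece_diff.
Proof.
split=> [a|k y].
  have [u Pu ua] : (e0 @` piece (ds 0%N) n) (submod_val a).
    by rewrite e0A; case: a.
  exists (piece_proj (ds 0%N) n u); apply: val_inj.
  by rewrite -[LHS]/(e0 (piece_val (piece_proj (ds 0%N) n u))) piece_projK.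
case: k y => [|k] y.
  have aug0 : piece_diff 0 y = 0 <-> (e 0%N @` piece (ds 1%N) n) (piece_val y).
    rewrite e0_ker; split=> [/(congr1 (@submod_val _ _ _)) ay|[_ ay]].
      by split; first exact: piece_valP.
    exact: val_inj.
  rewrite aug0; split=> [[u Pu uy]|[z <-]].
    exists (piece_proj (ds 1%N) n u); apply: piece_inj.
    by rewrite piece_diffE piece_projK.
  by exists (piece_val z); [exact: piece_valP | rewrite piece_diffE].
have d0 : piece_diff k.+1 y = 0 <-> (e k.+1 @` piece (ds k.+2) n) (piece_val y).
  rewrite e_ker; split=> [/(congr1 piece_val)|[_ ey]].
    by rewrite piece_diffE raddf0 => ey; split; first exact: piece_valP.
  by apply: piece_inj; rewrite piece_diffE [LHS]ey raddf0.
rewrite d0; split=> [[u Pu uy]|[z <-]].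
  exists (piece_proj (ds k.+2) n u); apply: piece_inj.
  by rewrite piece_diffE piece_projK.
by exists (piece_val z); [exact: piece_valP | rewrite piece_diffE].
Qed.

Lemma piece_projective k : projective (piece_complex k.+1).
Proof. exact: projective_Piece. Qed.

Let sigma k := tproj (r := r) N J (ds k) m n.

Lemma tproj_diff k c : tpiece N (ds k.+1) n c ->
  tensor_map B (piece_diff k.+1) (sigma k.+1 c) = sigma k (tdiff k c).
Proof.
move=> Cc.
suff : [set c | (tensor_map B (piece_diff k.+1) \o sigma k.+1) c = (sigma k \o tdiff k) c] c by [].
move: c Cc; apply: tpiece_min; first exact: submodset_eq.
move=> u y Pu.
suff : tensor_map B (piece_diff k.+1) (sigma k.+1 (tens u y)) = sigma k (tdiff k (tens u y)) by [].
have sE ds' v : tproj N J ds' m n (tens v y) =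
    tens (piece_proj ds' n v) (quotmod_pi _ y) by exact: tensor_bimapE.
have dE : tdiff k (tens u y) = tens (e k u) y by exact: tensor_mapE.
have pE : piece_diff k.+1 (piece_proj (ds k.+1) n u) = piece_proj (ds k) n (e k u).
  by apply: piece_inj; rewrite piece_diffE !piece_projK //; apply: eP.
rewrite dE /sigma !sE -pE; exact: tensor_mapE.
Qed.

(** Tor may be computed from [piece_complex]. Along the surjection [sigma i], whose kernel is J ^ m
    times the piece, cycles and boundaries pull back to cycles modulo J ^ m and to boundaries plus J
    ^ m times the piece. *)
Lemma Tor_piece_lengthE i l : has_length (Tor (submod A) B i) l <->
  rlen (boufam bs (tdiff i) (tpiece N (ds i.+1)) (tpiece N (ds i)) m n)
    (cycfam bs (prev_diff i) (tpiece N (ds i)) (prev_piece i) m n) l.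
Proof.
rewrite Tor_lengthE.
rewrite -(@homology_compare R B piece_complex (std_complex (submod A)) piece_diff
  (std_diff (submod A)) idfun idfun i l) //; last first.
- exact: std_exact.
- exact: piece_exact.
- exact: std_projective.
- exact: piece_projective.
have hC k : submodset (tpiece (r := r) N (ds k) n) by exact: submodset_tpiece.
have hpow k : submodset (bpow bs m (tpiece N (ds k) n)) := submodset_bpow _ _ (hC k).
have hbou : submodset (boufam bs (tdiff i) (tpiece N (ds i.+1)) (tpiece N (ds i)) m n).
  by apply: submodset_sumset => //; apply: submodset_image.
have hprev : submodset (prev_piece i n).
  by case: (i) => [|k]; apply: submodset_tpiece.
have hcyc : submodset (cycfam bs (prev_diff i) (tpiece N (ds i)) (prev_piece i) m n).
  by apply: submodsetI => //; exact/submodset_preimage/submodset_bpow.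
have cycE c : tpiece N (ds i) n c -> cycset B piece_diff i (sigma i c) <->
    bpow bs m (prev_piece i n) (prev_diff i c).
  case: (i) c => [|k] c Cc.
    by split=> // _; apply: submodset0; apply: submodset_bpow; apply: hC.
  rewrite -(tproj_ker sJ) -/(sigma k); last exact: tdiff_piece.
  by rewrite -tproj_diff.
have cycP c : cycfam bs (prev_diff i) (tpiece N (ds i)) (prev_piece i) m n c ->
    cycset B piece_diff i (sigma i c) by case=> Cc Dc; apply/cycE.
symmetry; apply: (rlen_map_onto (f := sigma i)) => //.
- exact: submodset_bouset.
- exact: submodset_cycset.
- move=> c [Cc _]; split.
    move=> [_ [c2 Cc2 <-] bc]; exists (sigma i.+1 c2) => //.
    rewrite tproj_diff //; apply/esym/subr0_eq; rewrite -linearB.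
    by apply/(tproj_ker sJ) => //; apply: bpow_sub bc.
  (* A boundary upstairs is lifted to [tdiff i c2]; the difference from c is killed by [sigma i],
     hence lies in J ^ m times the piece. *)
  move=> [w _ wc]; have [c2 Cc2 c2w] := @tproj_onto R r N J (ds i.+1) m n w.
  exists (tdiff i c2); first by exists c2.
  have Cd : tpiece N (ds i) n (c - tdiff i c2).
    by apply: submodsetB => //; apply: tdiff_piece.
  apply: (tproj_ker sJ m Cd).1; rewrite linearB -[tproj _ _ _ _ _]/(sigma i).
  by rewrite -tproj_diff // [sigma i.+1 c2]c2w wc subrr.
- apply: sumset_min => // [_ [c2 Cc2 <-]|c bc].
    split; first exact: tdiff_piece.
    by rewrite /preimage /mkset (prev_diff_diff Cc2); apply: submodset0; apply: submodset_bpow.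
  split; first exact: bpow_sub bc.
  by apply: bpow_linear bc => u; apply: prev_diff_piece.
- apply: bou_cyc => k x; apply/piece_exact.2; by exists x.
- move=> y cy; have [c Cc cE] := @tproj_onto R r N J (ds i) m n y.
  exists c; last first.
    by rewrite [sigma i c]cE subrr; apply: submodset0; apply: submodset_bouset.
  by split=> //; apply/cycE; rewrite // [sigma i c]cE.
Qed.

End TorOfPieces.

(** * The Rees module of M and the polynomial for Tor *)

Lemma presentable_bpow (R : comPzRingType) (a : seq R) (M : lmodType R) :
  fg_module M ->
  presentable (fun (k : 'I_(size a)) (v : M) => nth 0 a k *: v)
    (fun n => bpow a n setT).
Proof.
move=> [g gM]; set x := fun _ => _.
have hA n : submodset (bpow a n (@setT M)) by exact: submodset_bpow.
have xA z n v : z \in opseq x -> bpow a n setT v -> bpow a n.+1 setT (z v).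
  by move=> /mapP[k _ ->] Av; apply: (bmul_in _ Av); apply: mem_nth.
(* The Rees module is generated in degree 0 by generators of M: each factor from I is the action of
   a variable. *)
split=> //; exists [seq (0%N, 0%N, v) | v <- g].
  by move=> m n v /mapP[w _ [_ -> _]].
rewrite /const_fam => m n v Av; exists v; last by rewrite /zerofam /mkset subrr.
elim: n v Av => [|n IH] v Av; last first.
  apply: Av; first exact: submodset_gen.
  move=> b u bin /IH gu.
  have ltb : (index b a < size a)%N by rewrite index_mem.
  have -> : b *: u = x (Ordinal ltb) u by rewrite /x /= nth_index.
  apply: (gen_op (a := 0) (b := 1)) gu.
  by rewrite mem_cat map_f ?orbT // map_f // mem_enum.
elim: m => [|m IH]; last first.
  by apply: (gen_op (a := 1) (b := 0) (o := id)) IH; rewrite inE eqxx.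
have : v \in @fullm R M by [].
rewrite gM; move: v Av => v _; apply: (@span_minset _ _ _
  (gen (const_ops (opseq x)) [seq (0%N, 0%N, v) | v <- g] 0%N 0%N)).
  exact: submodset_gen.
by move=> w wg; apply: gen_in; apply: map_f.
Qed.


Theorem proposition3 (R : comPzRingType) (hR : noetherian_ring R)
    (I J : submodClosed R^o) (M N : lmodType R)
    (hM : fg_module M) (hN : fg_module N) (i : nat) :
  (exists m1 n1 : nat, forall m n : nat, (m1 <= m)%N -> (n1 <= n)%N ->
     finite_length (Tor (submod (ideal_exp_mod I n M))
                        (quotmod (ideal_exp_mod J m N)) i)) ->
  exists (p : {mpoly rat[2]}) (m0 n0 : nat),
    forall m n : nat, (m0 <= m)%N -> (n0 <= n)%N ->
      exists l : nat,
        has_length (Tor (submod (ideal_exp_mod I n M))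
                        (quotmod (ideal_exp_mod J m N)) i) l /\
        l%:R = p.@[fun k : 'I_2 => if k == ord0 then m%:R else n%:R].
Proof.
move=> [m1 [n1 fin]].
have [a aI] := hR I; have [b bJ] := hR J.
pose x (k : 'I_(size a)) (v : M) : M := (nth 0 a k : R) *: v.
have presA : presentable x (fun n => bpow a n setT) by exact: presentable_bpow.
have [||ds [e0 [e [e0A ex e0_ker e_ker]]]] := @graded_resolution _ hR _ _ x _ _ _ presA.
- by move=> k c u v; rewrite /x scalerDr !scalerA mulrC.
- by move=> k j v; rewrite /x !scalerA mulrC.
have eP k n u : piece (ds k.+1) n u -> piece (ds k) n (e k u).
  move=> Pu; have : (e k @` piece (ds k.+1) n)%classic (e k u) by exists u.
  by case: (k) => [|j]; rewrite ?e0_ker ?e_ker => -[].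
have ee0 k n u : piece (ds k.+2) n u -> e k (e k.+1 u) = 0.
  move=> Pu; have : (e k.+1 @` piece (ds k.+2) n)%classic (e k.+1 u) by exists u.
  by rewrite e_ker => -[].
have e0A' n : (e0 @` piece (ds 0%N) n = [set v | v \in ideal_exp_mod I n M])%classic.
  by rewrite e0A; apply/seteqP; split=> v /(ideal_exp_mod_bpow aI).
have TorE m n l := Tor_piece_lengthE N bJ eP ee0 m (e0A' n) (e0_ker n) (e_ker^~ n) i l.
pose Bd := boufam b (tdiff N e i) (tpiece N (ds i.+1)) (tpiece N (ds i)).
pose Cy := cycfam b (prev_diff N e i) (tpiece N (ds i)) (prev_piece ds i).
have finBC : evfinite Bd Cy.
  by exists m1, n1 => m n mm nn; have [l /TorE hl] := fin m n mm nn; exists l.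
have mulXN_tdiff k y v : y \in @mulXNs R (size a) N -> tdiff N e k (y v) = y (tdiff N e k v).
  move=> /mulXNP[j ->]; rewrite /mulXN /tdiff.
  pose h : {linear freeX R (size a) -> freeX R (size a)} := e k \o mulX R j.
  have h1 u : e k (mulX R j u) = h u by [].
  have h2 u : mulX R j (e k u) = h u by rewrite -ex.
  by rewrite (tensor_map_comp h1) (tensor_map_comp h2).
have [s [m0 [n0 hs]]] : evpoly (fun m n => (lenfam Bd Cy m n)%:R).
  apply: (homology_length_evpoly hR (xs := @mulXNs R (size a) N)) finBC.
  - exact: lin_mulXNs.
  - exact: comm_mulXNs.
  - exact: submodset_tpiece.
  - exact: submodset_tpiece.
  - by case: (i) => [|k] n; apply: submodset_tpiece.
  - exact: tpiece_mulXN.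
  - exact: tpiece_mulXN.
  - by case: (i) => [|k] y n v; apply: tpiece_mulXN.
  - exact: fg_tpiece.
  - by case: (i) => [|k]; apply: fg_tpiece.
  - case: (i) => [|k] y v yin; last exact: mulXN_tdiff.
    by rewrite /= (map0_linear (lin_mulXNs yin)).
  - by move=> y v; apply: mulXN_tdiff.
  - exact: prev_diff_piece.
  - exact: tdiff_piece.
  - exact: prev_diff_diff.
have [p pE] := binform_mpoly s.
(* The bounds m1 and n1 enter as well, since [len] is a genuine length only where it is finite. *)
exists p, (maxn m0 m1), (maxn n0 n1) => m n.
rewrite !geq_max => /andP[m0m m1m] /andP[n0n n1n].
have [l hl] := fin m n m1m n1n; exists l; split=> //.
by rewrite -pE -hs // /lenfam (lenE ((TorE m n l).1 hl)).
Qed.
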